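(* Let $\mathcal{U}_c$ denote the unital associative subalgebra of the rational Cherednik algebra $\mathsf{H}_c$ generated by $\mathbb{C}W$ and the elements $\mathcal{X}_{ij}=x_iy_j-x_jy_i$ with $1\le i<j\le r$. Then, for every parameter $c$, $\mathcal{U}_c$ is the centraliser algebra in $\mathsf{H}_c$ of the Lie subalgebra $\mathfrak{s}\cong\mathfrak{sl}(2,\mathbb{C})$ spanned by $H=\tfrac12\sum_i(x_iy_i+y_ix_i)$, $E_1^+=-\tfrac12\sum_i x_i^2$ and $E_1^-=\tfrac12\sum_i y_i^2$.
   Context: Let $E=\mathbb{R}^r$ be a Euclidean space with inner product $(\cdot,\cdot)$, identified with $E^*$ by means of it. Let $R\subseteq E^*$ be a finite root system (not necessarily crystallographic), $R_+$ a set of positive roots (write $\alpha>0$ for $\alpha\in R_+$), $W$ the finite real reflection group generated by the reflections $s_\alpha$, and $\alpha^\vee=2\alpha/(\alpha,\alpha)$ viewed in $E$. Let $c:R\to\mathbb{C}$, $\alpha\mapsto c_\alpha$, be $W$-invariant. Put $\mathfrak{h}=E\otimes_{\mathbb{R}}\mathbb{C}$ and let $\langle\cdot,\cdot\rangle:\mathfrak{h}^*\times\mathfrak{h}\to\mathbb{C}$ be the natural pairing. The rational Cherednik algebra $\mathsf{H}_c$ (at $t=1$) is the quotient of $T(\mathfrak{h}\oplus\mathfrak{h}^* )\#W$ (smash product of the tensor algebra with $W$) by the relations $[y,y']=0=[x,x']$ and $[y,x]=\langle x,y\rangle-\sum_{\alpha>0}c_\alpha\langle\alpha,y\rangle\langle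 x,\alpha^\vee\rangle s_\alpha$ for $y,y'\in\mathfrak{h}$, $x,x'\in\mathfrak{h}^*$. Fix an orthonormal basis $\{y_1,\dots,y_r\}$ of $E\subseteq\mathfrak{h}$ and let $\{x_1,\dots,x_r\}\subseteq E^*\subseteq \mathfrak{h}^*$ be the dual basis. *)

(* Defs.v *)
(* The reals are an arbitrary [R : realType], the complex numbers are [R[i]]. *)
From HB Require Import structures.
From mathcomp Require Import all_boot all_order all_algebra.
From mathcomp Require Import sesquilinear generic_quotient ring_quotient.
From mathcomp Require Import finmap boolp reals complex monalg.

Set Implicit Arguments.
Unset Strict Implicit.
Unset Printing Implicit Defensive.

Import Order.TTheory GRing.Theory Num.Theory.
Local Open Scope ring_scope.
Local Open Scope quotient_scope.
Local Open Scope complex_scope.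

Definition free_algebra (K : comNzRingType) (I : choiceType) :=
  {malg K[{fmonom I}]}.

Section FreeAlgebra.
Variables (K : comNzRingType) (I : choiceType).
Local Notation F := (free_algebra K I).

HB.instance Definition _ := GRing.Lalgebra.on F.

Fact free_scalerAr (a : K) (u v : F) : a *: (u * v) = u * (a *: v).
Proof.
apply/malgP => m; rewrite mcoeffZ mcoeffMl.
rewrite (mcoeffMlw m (fsubset_refl _) (msuppZ_le a v)) mulr_sumr.
apply: eq_bigr => m1 _; rewrite mulr_sumr; apply: eq_bigr => m2 _.
by rewrite mcoeffZ mulrnAr mulrCA.
Qed.

HB.instance Definition _ := GRing.Lalgebra_isAlgebra.Build K F free_scalerAr.

End FreeAlgebra.

HB.lock Definition free_gen (K : comNzRingType) (I : choiceType) (i : I) :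
  free_algebra K I := << fmu i >>.

(* The algebra obtained from [A] by imposing the relations [u = v] for
   [rel u v]. It may be trivial, hence is a [pzRingType]: MathComp's [algType]
   includes 1 != 0. *)
Section QuotientAlgebra.
Variables (K : comNzRingType) (A : algType K) (rel : A -> A -> Prop).

Inductive in_ideal : A -> Prop :=
| in_ideal_rel u v : rel u v -> in_ideal (u - v)
| in_ideal0 : in_ideal 0
| in_idealD u v : in_ideal u -> in_ideal v -> in_ideal (u + v)
| in_idealM a u b : in_ideal u -> in_ideal (a * u * b).

Definition ideal : {pred A} := fun u => `[< in_ideal u >].

Fact ideal_zmod_closed : zmod_closed ideal.
Proof.
split=> [|u v /asboolP Iu /asboolP Iv]; apply/asboolP; first exact: in_ideal0.
apply: in_idealD => //; rewrite -[- v]mulN1r -[_ * v]mulr1.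
exact: in_idealM.
Qed.
HB.instance Definition _ := GRing.isZmodClosed.Build A ideal ideal_zmod_closed.

Lemma idealM a u b : u \in ideal -> a * u * b \in ideal.
Proof. by move=> /asboolP Iu; apply/asboolP/in_idealM. Qed.
Lemma idealMl a u : u \in ideal -> a * u \in ideal.
Proof. by move=> Iu; rewrite -[_ * u]mulr1 idealM. Qed.
Lemma idealMr u b : u \in ideal -> u * b \in ideal.
Proof. by move=> Iu; rewrite -[u]mul1r idealM. Qed.
Lemma idealZ a u : u \in ideal -> a *: u \in ideal.
Proof. by move=> Iu; rewrite -[u]mul1r scalerAl idealMl. Qed.

Definition quot_algebra := Quotient.quot ideal.
Local Notation Q := quot_algebra.

HB.instance Definition _ := GRing.Zmodule.on Q.
HB.instance Definition _ := EqQuotient.on Q.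

Definition quot_pi (u : A) : Q := \pi_Q u.

Lemma quot_piP u v : quot_pi u = quot_pi v <-> u - v \in ideal.
Proof.
split=> [/eqP|Iuv]; first by rewrite /quot_pi -Quotient.idealrBE.
by apply/eqP; rewrite /quot_pi -Quotient.idealrBE.
Qed.

Lemma quot_pi_rel u v : rel u v -> quot_pi u = quot_pi v.
Proof. by move=> uv; apply/quot_piP/asboolP/in_ideal_rel. Qed.

Lemma quot_pi_surj (q : Q) : exists u, q = quot_pi u.
Proof. by exists (repr q); rewrite /quot_pi reprK. Qed.

Definition quot_one : Q := lift_cst Q 1.
Definition quot_mul : Q -> Q -> Q := lift_op2 Q *%R.
Definition quot_scale (a : K) : Q -> Q := lift_op1 Q ( *:%R a).

Lemma quot_repr u : repr (quot_pi u) - u \in ideal.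
Proof. by apply/quot_piP; rewrite /quot_pi reprK. Qed.

Lemma quot_piM u v : quot_pi (u * v) = quot_mul (quot_pi u) (quot_pi v).
Proof.
rewrite /quot_mul; unlock.
apply/esym/quot_piP; rewrite -(subrKA (u * repr (quot_pi v))) -mulrBl -mulrBr.
by apply: rpredD; [apply: idealMr | apply: idealMl]; exact: quot_repr.
Qed.

Lemma quot_pi1 : quot_pi 1 = quot_one.
Proof. by rewrite /quot_one; unlock. Qed.

Lemma quot_piZ a u : quot_pi (a *: u) = quot_scale a (quot_pi u).
Proof.
by rewrite /quot_scale; unlock; apply/esym/quot_piP; rewrite -scalerBr idealZ ?quot_repr. Qed.

Lemma quot_piD u v : quot_pi (u + v) = quot_pi u + quot_pi v.
Proof. exact: (Quotient.pi_add ideal). Qed.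

Fact quot_mulA : associative quot_mul.
Proof.
move=> p q s; have [[u ->] [v ->] [w ->]] :=
  And3 (quot_pi_surj p) (quot_pi_surj q) (quot_pi_surj s).
by rewrite -!quot_piM mulrA.
Qed.
Fact quot_mul1 : left_id quot_one quot_mul.
Proof. by move=> p; have [u ->] := quot_pi_surj p; rewrite -quot_pi1 -quot_piM mul1r. Qed.
Fact quot_mulr1 : right_id quot_one quot_mul.
Proof. by move=> p; have [u ->] := quot_pi_surj p; rewrite -quot_pi1 -quot_piM mulr1. Qed.
Fact quot_mulDl : left_distributive quot_mul +%R.
Proof.
move=> p q s; have [[u ->] [v ->] [w ->]] :=
  And3 (quot_pi_surj p) (quot_pi_surj q) (quot_pi_surj s).
by rewrite -!(quot_piM, quot_piD) mulrDl.
Qed.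
Fact quot_mulDr : right_distributive quot_mul +%R.
Proof.
move=> p q s; have [[u ->] [v ->] [w ->]] :=
  And3 (quot_pi_surj p) (quot_pi_surj q) (quot_pi_surj s).
by rewrite -!(quot_piM, quot_piD) mulrDr.
Qed.
HB.instance Definition _ := GRing.Zmodule_isPzRing.Build Q
  quot_mulA quot_mul1 quot_mulr1 quot_mulDl quot_mulDr.

Fact quot_scaleA a b p : quot_scale a (quot_scale b p) = quot_scale (a * b) p.
Proof. by have [u ->] := quot_pi_surj p; rewrite -!quot_piZ scalerA. Qed.
Fact quot_scale1 : left_id 1 quot_scale.
Proof. by move=> p; have [u ->] := quot_pi_surj p; rewrite -quot_piZ scale1r. Qed.
Fact quot_scaleDr : right_distributive quot_scale +%R.
Proof.
move=> a p q; have [[u ->] [v ->]] := conj (quot_pi_surj p) (quot_pi_surj q).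
by rewrite -!(quot_piZ, quot_piD) scalerDr.
Qed.
Fact quot_scaleDl p : {morph quot_scale^~ p : a b / a + b}.
Proof.
by move=> a b; have [u ->] := quot_pi_surj p; rewrite -!(quot_piZ, quot_piD) scalerDl.
Qed.
HB.instance Definition _ := GRing.Zmodule_isLmodule.Build K Q
  quot_scaleA quot_scale1 quot_scaleDr quot_scaleDl.

Lemma quot_pi_is_zmod_morphism : zmod_morphism quot_pi.
Proof.
by move=> u v; apply: (addIr (quot_pi v)); rewrite -quot_piD !subrK.
Qed.
HB.instance Definition _ :=
  GRing.isZmodMorphism.Build A Q quot_pi quot_pi_is_zmod_morphism.
Lemma quot_pi_is_monoid_morphism : monoid_morphism quot_pi.
Proof. by split=> [|u v]; rewrite ?quot_pi1 ?quot_piM. Qed.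
HB.instance Definition _ :=
  GRing.isMonoidMorphism.Build A Q quot_pi quot_pi_is_monoid_morphism.
HB.instance Definition _ := GRing.isScalable.Build K A Q *:%R quot_pi quot_piZ.

Lemma quot_scalerAl (a : K) (p q : Q) : a *: (p * q) = a *: p * q.
Proof.
have [[u ->] [v ->]] := conj (quot_pi_surj p) (quot_pi_surj q).
by rewrite -rmorphM -!linearZ -rmorphM scalerAl.
Qed.
Lemma quot_scalerAr (a : K) (p q : Q) : a *: (p * q) = p * (a *: q).
Proof.
have [[u ->] [v ->]] := conj (quot_pi_surj p) (quot_pi_surj q).
by rewrite -rmorphM -!linearZ -rmorphM scalerAr.
Qed.

Lemma ideal_ker (B : pzRingType) (f : {rmorphism A -> B}) u :
  (forall a b, rel a b -> f a = f b) -> u \in ideal -> f u = 0.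
Proof.
move=> frel /asboolP; elim=> [a b /frel fab||a b _ fa _ fb|a v b _ fv].
- by rewrite rmorphB fab subrr.
- by rewrite rmorph0.
- by rewrite rmorphD fa fb addr0.
- by rewrite !rmorphM fv mulr0 mul0r.
Qed.

End QuotientAlgebra.

Section SubalgebrasCentralisers.
Variables (K : comNzRingType) (A : algType K) (rel : A -> A -> Prop).
Local Notation Q := (quot_algebra rel).
Implicit Types S : Q -> Prop.

Inductive generated_subalgebra S : Q -> Prop :=
| gen_subalg_mem p : S p -> generated_subalgebra S p
| gen_subalg_1 : generated_subalgebra S 1
| gen_subalg_lin a p q : generated_subalgebra S p ->
    generated_subalgebra S q -> generated_subalgebra S (a *: p + q)
| gen_subalg_mul p q : generated_subalgebra S p ->
    generated_subalgebra S q -> generated_subalgebra S (p * q).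

Definition centraliser S (p : Q) : Prop := forall s, S s -> GRing.comm p s.

Definition span3 (u v w : Q) (p : Q) : Prop :=
  exists a b c : K, p = a *: u + b *: v + c *: w.

(* [phi] only matters on the trace-zero matrices. That [S] is closed under the
   commutator follows. *)
Definition isomorphic_sl2 S : Prop :=
  exists phi : {linear 'M[K]_2 -> Q},
    [/\ forall M, \tr M = 0 -> phi M = 0 -> M = 0,
        forall p, S p <-> exists2 M, \tr M = 0 & p = phi M
      & forall M N, \tr M = 0 -> \tr N = 0 ->
          phi (M *m N - N *m M) = phi M * phi N - phi N * phi M].

End SubalgebrasCentralisers.

Section RootSystems.
Variables (R : realType) (r : nat) (ip : {dot 'cV[R]_r for idfun}).
Local Notation E := 'cV[R]_r.
Implicit Types (a v : E) (Phi : {fset E}).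

(* Elements of the dual space of E are row vectors, paired with E by the matrix
   product. Roots are stored as vectors of E, through the identification of E
   with its dual: as a functional, the root [a] is [flat a] = (a, -). *)
Definition flat a : 'rV[R]_r := \row_j ip a (delta_mx j 0).
Definition coroot a : E := (2 / ip a a) *: a.
Definition reflection a : 'M[R]_r := 1%:M - coroot a *m flat a.

(* Root systems are reduced; they need be neither crystallographic nor
   spanning. *)
Definition is_root_system Phi : Prop :=
  [/\ 0 \notin Phi,
      forall a b, a \in Phi -> b \in Phi -> reflection a *m b \in Phi
    & forall a (k : R), a \in Phi -> k *: a \in Phi -> k = 1 \/ k = -1].

Definition is_positive_system Phi (Pos : {set Phi}) : Prop :=
  exists v, (forall a : Phi, ip (val a) v != 0)
         /\ Pos = [set a : Phi | 0 < ip (val a) v].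

Inductive in_reflection_group Phi : 'M[R]_r -> Prop :=
| in_refl_group1 : in_reflection_group Phi 1%:M
| in_refl_group_refl a : a \in Phi -> in_reflection_group Phi (reflection a)
| in_refl_groupM g h : in_reflection_group Phi g ->
    in_reflection_group Phi h -> in_reflection_group Phi (g *m h)
| in_refl_groupV g : in_reflection_group Phi g ->
    in_reflection_group Phi (invmx g).

Definition weyl_group Phi := {g : 'M[R]_r | `[< in_reflection_group Phi g >]}.
HB.instance Definition _ Phi := Choice.on (weyl_group Phi).
HB.instance Definition _ Phi := SubType.on (weyl_group Phi).

Definition reflectionW Phi (a : Phi) : weyl_group Phi :=
  exist _ (reflection (val a))
    (introT (asboolP _) (in_refl_group_refl (valP a))).

Definition W_invariant Phi (c : Phi -> R[i]) : Prop :=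
  forall (w : weyl_group Phi) (a b : Phi), val b = val w *m val a -> c b = c a.

End RootSystems.

Section RationalCherednikAlgebra.
Variables (R : realType) (r : nat) (ip : {dot 'cV[R]_r for idfun}).
Variables (Phi : {fset 'cV[R]_r}) (Pos : {set Phi}) (c : Phi -> R[i]).
Local Notation C := R[i].
Local Notation W := (weyl_group ip Phi).

(* Entrywise extension of scalars from R to C. *)
Definition complexify m n (M : 'M[R]_(m, n)) : 'M[C]_(m, n) :=
  map_mx (real_complex R) M.

(* The direct sum of h (complex columns) and its dual (complex rows). *)
Definition hh := ('cV[C]_r * 'rV[C]_r)%type.
HB.instance Definition _ := GRing.Lmodule.on hh.

Definition pairing (x : 'rV[C]_r) (y : 'cV[C]_r) : C := (x *m y) 0 0.

Definition act (w : W) (u : hh) : hh :=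
  (complexify (val w) *m u.1, u.2 *m complexify (invmx (val w))).

Definition smash_letter : choiceType := (hh + W)%type.
Local Notation F := (free_algebra C smash_letter).
Definition free_vec (u : hh) : F := free_gen C (inl u : smash_letter).
Definition free_grp (w : W) : F := free_gen C (inr w : smash_letter).

Inductive smash_rel : F -> F -> Prop :=
| smash_linear k u v :
    smash_rel (free_vec (k *: u + v)) (k *: free_vec u + free_vec v)
| smash_grp1 w : val w = 1%:M -> smash_rel (free_grp w) 1
| smash_grpM w1 w2 w3 : val w3 = val w1 *m val w2 ->
    smash_rel (free_grp w3) (free_grp w1 * free_grp w2)
| smash_act w u :
    smash_rel (free_grp w * free_vec u) (free_vec (act w u) * free_grp w).

(* The smash product of W with the tensor algebra of [hh]: linearity gives the tensor algebra, the group law gives CW,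
   and the last relation is w u w^-1 = w(u). *)
Definition smash := quot_algebra smash_rel.
HB.instance Definition _ := GRing.PzRing.on smash.
HB.instance Definition _ := GRing.Lmodule.on smash.

(* The augmentation u |-> 0, w |-> 1 *)
Definition smash_aug_letters (m : {fmonom smash_letter}) : C :=
  (all (fun l : smash_letter => if l is inr _ then true else false) m)%:R.

Fact smash_aug_mmorphism : mmorphism smash_aug_letters.
Proof.
split=> [m n|]; last by rewrite /smash_aug_letters fm1.
by rewrite /smash_aug_letters fmM all_cat -mulnb natrM.
Qed.
HB.instance Definition _ :=
  isMultiplicative.Build _ _ smash_aug_letters smash_aug_mmorphism.

Fact smash_one_neq0 : 1 != 0 :> smash.
Proof.
apply/eqP => E; have: quot_pi smash_rel 1 = quot_pi smash_rel 0.
  by rewrite rmorph1 rmorph0.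
move/quot_piP; rewrite subr0 => I1.
pose f : {rmorphism F -> C} := mmap idfun smash_aug_letters.
have fZ k x : f (k *: x) = k * f x by exact: (mmapZ (f := idfun)).
have fv u : f (free_vec u) = 0.
  by rewrite /f /= ?/free_vec ?/free_grp free_gen.unlock mmapU /smash_aug_letters fmU /= mulr0.
have fg w : f (free_grp w) = 1.
  by rewrite /f /= ?/free_vec ?/free_grp free_gen.unlock mmapU /smash_aug_letters fmU /= mulr1.
suff /(ideal_ker (f := f))/(_ I1) /eqP : forall a b, smash_rel a b -> f a = f b.
  by rewrite rmorph1 oner_eq0.
move=> a b; case=> [k u v|w _|w1 w2 w3 _|w u].
- by rewrite rmorphD fZ !fv mulr0 addr0.
- by rewrite fg rmorph1.
- by rewrite rmorphM !fg mulr1.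
- by rewrite !rmorphM !fv mulr0 mul0r.
Qed.
HB.instance Definition _ :=
  GRing.PzSemiRing_isNonZero.Build smash smash_one_neq0.
HB.instance Definition _ :=
  GRing.Lmodule_isLalgebra.Build C smash (@quot_scalerAl _ _ smash_rel).
HB.instance Definition _ :=
  GRing.Lalgebra_isAlgebra.Build C smash (@quot_scalerAr _ _ smash_rel).

Definition smash_y (y : 'cV[C]_r) : smash := quot_pi smash_rel (free_vec (y, 0)).
Definition smash_x (x : 'rV[C]_r) : smash := quot_pi smash_rel (free_vec (0, x)).
Definition smash_w (w : W) : smash := quot_pi smash_rel (free_grp w).

Inductive cherednik_rel : smash -> smash -> Prop :=
| cherednik_yy y y' :
    cherednik_rel (smash_y y * smash_y y' - smash_y y' * smash_y y) 0
| cherednik_xx x x' :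
    cherednik_rel (smash_x x * smash_x x' - smash_x x' * smash_x x) 0
| cherednik_yx y x :
    cherednik_rel (smash_y y * smash_x x - smash_x x * smash_y y)
      ((pairing x y)%:A
       - \sum_(a in Pos) (c a * pairing (complexify (flat ip (val a))) y
                          * pairing x (complexify (coroot ip (val a))))
                         *: smash_w (reflectionW ip a)).

Definition cherednik := quot_algebra cherednik_rel.
HB.instance Definition _ := GRing.PzRing.on cherednik.
HB.instance Definition _ := GRing.Lmodule.on cherednik.

Definition cher_y (y : 'cV[R]_r) : cherednik :=
  quot_pi cherednik_rel (smash_y (complexify y)).
Definition cher_x (x : 'rV[R]_r) : cherednik :=
  quot_pi cherednik_rel (smash_x (complexify x)).
Definition cher_w (w : W) : cherednik := quot_pi cherednik_rel (smash_w w).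

Definition group_algebra (p : cherednik) : Prop :=
  exists s : seq (C * W), p = \sum_(t <- s) t.1 *: cher_w t.2.

Variables (x : 'I_r -> 'rV[R]_r) (y : 'I_r -> 'cV[R]_r).
Local Notation X i := (cher_x (x i)).
Local Notation Y i := (cher_y (y i)).

Definition angular (i j : 'I_r) : cherednik := X i * Y j - X j * Y i.

Definition U_gens (p : cherednik) : Prop :=
  group_algebra p \/ exists i j : 'I_r, (i < j)%N /\ p = angular i j.

Definition sl2_H : cherednik := (2^-1 : C) *: \sum_i (X i * Y i + Y i * X i).
Definition sl2_Ep : cherednik := - ((2^-1 : C) *: \sum_i X i ^+ 2).
Definition sl2_Em : cherednik := (2^-1 : C) *: \sum_i Y i ^+ 2.

End RationalCherednikAlgebra.

(* Main.v *)
Require Import Defs.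
From HB Require Import structures.
From mathcomp Require Import all_boot all_order all_algebra.
From mathcomp Require Import sesquilinear finmap boolp reals complex.
From mathcomp Require Import ring.
From mathcomp Require monalg mpoly.

Set Implicit Arguments.
Unset Strict Implicit.
Unset Printing Implicit Defensive.

Import Order.TTheory GRing.Theory Num.Theory.
Local Open Scope ring_scope.

(** Write e = E_1^+, f = E_1^- and h = H, and let these act on the algebra by
    commutators.  The defining relation gives
      [e, x] = 0,  [e, y] = x,  [f, x] = y,  [f, y] = 0
    when x and y correspond under the identification of the Euclidean space
    with its dual: the terms with reflections cancel, because each reflection
    s anticommutes with its own root ([sq_norm_ad]).  So every pair (x_i, y_i)
    spans a copy of the standard two-dimensional representation of sl(2), and W
    mixes the copies while commuting with sl(2).  An angular momentum
    x_i y_j - x_j y_i is the invariant of two such copies, hence U lies in the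
    centraliser.

    For the converse it is enough to describe the algebra as an sl(2)-module
    up to elements of U acting from the left ([sl2_invariants_generated]).
    Let HW(m) be the left U-span of the monomials of degree m in the x_i; it
    consists of highest weight vectors of weight m.  The algebra is the sum of
    the strings ad(f)^k HW(m): this sum contains 1, and it is stable under
    right multiplication by the generators.  For x_j and y_j this is the
    Clebsch-Gordan decomposition V_m (x) V_1 = V_{m+1} + V_{m-1}, whose second
    projection is made explicit by
      [f, p] x_j - m p y_j  in  HW(m-1)   for p in HW(m)
    ([hw_clebsch_gordan]): commutative algebra would turn the left-hand side
    into a sum of monomials of degree m - 1 times angular momenta, and every
    reordering that the relations require leaves an element of the group
    algebra, which can be moved to the left.  The adjoint Casimir operator acts
    on the strings of HW(m) by m (m + 2), and it kills an element that commutes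
    with e and f.  As these eigenvalues are distinct, such an element lies in
    HW(0), which is U.

    That e, f and h are linearly independent depends on the algebra not being
    too small: as [h, x] = x, the vanishing of h would force every x to vanish.
    The polynomial representation excludes this ([cher_x_eq0]).  There the
    y act by Dunkl operators; these commute because their commutator kills the
    constants and commutes with multiplication by linear forms ([dunklC]). *)

(** * Modules over free algebras and their quotients *)

Module FreeAction.
Import monalg.

Section FreeAction.
Variables (K : comNzRingType) (I : choiceType).
Local Notation F := (free_algebra K I).
Local Notation gen := (@free_gen K I).

Lemma free_ind (P : F -> Prop) : P 1 ->
  (forall a u v, P u -> P v -> P (a *: u + v)) ->
  (forall u i, P u -> P (u * gen i)) -> forall u, P u.
Proof.
move=> P1 Plin Pgen u.
have P0 : P 0 by rewrite -(subrr 1) addrC -scaleN1r; apply: Plin.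
have PZ a v : P v -> P (a *: v) by rewrite -[a *: v]addr0 => Pv; apply: Plin.
have PD v w : P v -> P w -> P (v + w) by rewrite -{2}[v]scale1r; apply: Plin.
rewrite [u]monalgE; elim/big_ind: _ => // m _.
have -> : << u@_m *g m >> = u@_m *: (<< m >> : F).
  by apply/malgP => k; rewrite mcoeffZ !mcoeffU mulr_natr.
apply: PZ; case: m => s; elim/last_ind: s => [|s i IHs].
  by rewrite -fmoneE.
have -> : << FMonom (rcons s i) >> = << FMonom s >> * gen i :> F.
  rewrite free_gen.unlock [RHS]fgmulUU mul1r -cats1; congr << _ >>.
  by apply/eqP; rewrite fmP fmM fmU.
exact: Pgen.
Qed.

Variables (M : lmodType K) (op : I -> M -> M).
Hypothesis op_lin : forall i a s t, op i (a *: s + t) = a *: op i s + op i t.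

Definition word_act (m : seq I) (t : M) : M := foldr op t m.

Definition free_act (u : F) (t : M) : M :=
  \sum_(m <- msupp u) u@_m *: word_act m t.

Lemma word_act_lin m a s t :
  word_act m (a *: s + t) = a *: word_act m s + word_act m t.
Proof. by elim: m => //= i m ->. Qed.

Lemma free_actEw (d : {fset {fmonom I}}) u t : (msupp u `<=` d)%fset ->
  free_act u t = \sum_(m <- d) u@_m *: word_act m t.
Proof.
move=> le; rewrite [LHS](big_fset_incl _ le) // => m _ /mcoeff_outdom ->.
by rewrite scale0r.
Qed.

Lemma free_act_lin a u v t : free_act (a *: u + v) t = a *: free_act u t + free_act v t.
Proof.
pose d := (msupp u `|` msupp v)%fset.
rewrite !(@free_actEw d) ?fsubsetUl ?fsubsetUr //.
  rewrite scaler_sumr -big_split /=; apply: eq_bigr => m _.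
  by rewrite mcoeffD mcoeffZ scalerDl scalerA.
apply: fsubset_trans (msuppD_le _ _) _; apply: fsetSU; exact: msuppZ_le.
Qed.

Lemma free_act_linr u a s t : free_act u (a *: s + t) = a *: free_act u s + free_act u t.
Proof.
rewrite /free_act scaler_sumr -big_split; apply: eq_bigr => m _ /=.
by rewrite word_act_lin scalerDr !scalerA mulrC.
Qed.

Lemma free_actU m t : free_act << m >> t = word_act m t.
Proof. by rewrite (free_actEw _ msuppU_le) big_seq_fset1 mcoeffUU scale1r. Qed.

Lemma free_act_gen i t : free_act (gen i) t = op i t.
Proof. by rewrite free_gen.unlock free_actU fmU. Qed.

Lemma free_act1 t : free_act 1 t = t.
Proof. by rewrite free_actU fm1. Qed.

Lemma free_act0 t : free_act 0 t = 0.
Proof. by rewrite /free_act msupp0 big_seq_fset0. Qed.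

Lemma free_actM u v t : free_act (u * v) t = free_act u (free_act v t).
Proof.
have actD : {morph free_act^~ t : p q / p + q}.
  by move=> p q; have := free_act_lin 1 p q t; rewrite !scale1r.
rewrite [u * v]fgmulEl1 (big_morph _ actD (free_act0 _)).
apply: eq_bigr => m _; rewrite fgmulUg (big_morph _ actD (free_act0 _)).
have word_sum (J : Type) (r : seq J) (a : J -> K) (b : J -> M) :
    word_act m (\sum_(j <- r) a j *: b j) = \sum_(j <- r) a j *: word_act m (b j).
  elim: r => [|j r IHr]; last by rewrite !big_cons word_act_lin IHr.
  rewrite !big_nil -[X in word_act m X]addr0 -[X in X + _](scaler0 _ (-1)).
  by rewrite word_act_lin scaleN1r addNr.
rewrite [free_act v t]/free_act word_sum scaler_sumr; apply: eq_bigr => n _.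
rewrite (free_actEw _ msuppU_le) big_seq_fset1 mcoeffUU scalerA.
by rewrite fmM /word_act foldr_cat.
Qed.

End FreeAction.

End FreeAction.
Import FreeAction.

(** A module over an algebra descends to the quotient as soon as the imposed
    relations hold on it; the induced action evaluates a class on any
    representative. *)
Section QuotientAction.
Variables (K : comNzRingType) (A : algType K) (rel : A -> A -> Prop).
Variables (M : lmodType K) (op : A -> M -> M).
Hypothesis op_lin : forall a u v t, op (a *: u + v) t = a *: op u t + op v t.
Hypothesis op_linr : forall u a s t, op u (a *: s + t) = a *: op u s + op u t.
Hypothesis opM : forall u v t, op (u * v) t = op u (op v t).
Hypothesis op_rel : forall u v, rel u v -> forall t, op u t = op v t.

Definition quot_act (q : quot_algebra rel) (t : M) : M := op (repr q) t.

Lemma quot_actE u t : quot_act (quot_pi rel u) t = op u t.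
Proof.
have opB a b s : op (a - b) s = op a s - op b s.
  by have := op_lin (-1) b a s; rewrite !scaleN1r ![- _ + _]addrC.
have op0 s : op 0 s = 0 by rewrite -(subrr 0) opB subrr.
have op0r a : op a 0 = 0.
  by have := op_linr a (-1) 0 0; rewrite !scaleN1r !addNr.
apply/subr0_eq; rewrite /quot_act -opB.
have /asboolP Iu := quot_repr rel u.
elim: Iu t => {u} [a b ab t||a b _ IHa _ IHb t|a u b _ IHu t].
- by rewrite opB (op_rel ab) subrr.
- exact: op0.
- by rewrite -[a]scale1r op_lin IHa IHb scaler0 addr0.
- by rewrite !opM IHu op0r.
Qed.

End QuotientAction.

(** * Commutators and the adjoint Casimir operator *)

HB.lock Definition comm_ad (A : pzRingType) (a p : A) : A := a * p - p * a.

Section Commutators.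
Variable A : pzRingType.
Implicit Types a b p q : A.

Lemma comm_adE a p : comm_ad a p = a * p - p * a.
Proof. by rewrite comm_ad.unlock. Qed.

Lemma comm_ad0 a : comm_ad a 0 = 0.
Proof. by rewrite !comm_adE mulr0 mul0r subrr. Qed.

Lemma comm_ad1 a : comm_ad a 1 = 0.
Proof. by rewrite !comm_adE mulr1 mul1r subrr. Qed.

Lemma comm_adD a p q : comm_ad a (p + q) = comm_ad a p + comm_ad a q.
Proof. by rewrite !comm_adE mulrDr mulrDl opprD addrACA. Qed.

Lemma comm_adN a p : comm_ad a (- p) = - comm_ad a p.
Proof. by rewrite !comm_adE mulrN mulNr opprD. Qed.

Lemma comm_adDl a b p : comm_ad (a + b) p = comm_ad a p + comm_ad b p.
Proof. by rewrite !comm_adE mulrDl mulrDr opprD addrACA. Qed.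

Lemma comm_adNl a p : comm_ad (- a) p = - comm_ad a p.
Proof. by rewrite !comm_adE mulNr mulrN opprB opprK addrC. Qed.

Lemma comm_ad_antisym a p : comm_ad a p = - comm_ad p a.
Proof. by rewrite !comm_adE opprB. Qed.

Lemma comm_adMn a p n : comm_ad a (p *+ n) = comm_ad a p *+ n.
Proof. by rewrite !comm_adE mulrnAr mulrnAl mulrnBl. Qed.

Lemma comm_adM a p q : comm_ad a (p * q) = comm_ad a p * q + p * comm_ad a q.
Proof. by rewrite !comm_adE mulrBl mulrBr !mulrA addrA subrK. Qed.

Lemma comm_ad_sum a I (s : seq I) (F : I -> A) :
  comm_ad a (\sum_(i <- s) F i) = \sum_(i <- s) comm_ad a (F i).
Proof.
rewrite comm_adE mulr_sumr mulr_suml -sumrB.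
by apply: eq_bigr => i _; rewrite comm_adE.
Qed.

Lemma comm_ad_commute a p : comm_ad a p = 0 <-> GRing.comm p a.
Proof.
by rewrite comm_adE /GRing.comm; split=> [/subr0_eq->|->] //; rewrite subrr.
Qed.

Lemma comm_adB a p q : comm_ad a (p - q) = comm_ad a p - comm_ad a q.
Proof. by rewrite comm_adD comm_adN. Qed.

Lemma comm_ad_jacobi a b p :
  comm_ad (comm_ad a b) p = comm_ad a (comm_ad b p) - comm_ad b (comm_ad a p).
Proof.
rewrite (comm_adE b p) comm_adB !comm_adM opprD [- _ - _]addrC addrACA.
by rewrite -!(comm_adE _ (comm_ad _ _)) -comm_adE addrK.
Qed.
End Commutators.

(** The Casimir operator h^2 + 2h + 4fe of the adjoint action, where h = [e, f];
    it is written for e acting first, so that it reduces to h^2 + 2h on vectors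
    killed by e. *)
Definition casimir (A : pzRingType) (e f p : A) : A :=
  let h := comm_ad e f in
  comm_ad h (comm_ad h p) + comm_ad h p *+ 2 + comm_ad f (comm_ad e p) *+ 4.

Section Casimir.
Variables (A : pzRingType) (e f : A).
Local Notation h := (comm_ad e f).
Hypothesis hf : comm_ad h f = - (f *+ 2).

Lemma casimirD p q : casimir e f (p + q) = casimir e f p + casimir e f q.
Proof.
rewrite /casimir !comm_adD !mulrnDl.
by rewrite [X in X + _]addrACA [LHS]addrACA.
Qed.

Lemma casimir0 : casimir e f 0 = 0.
Proof. by rewrite /casimir !comm_ad0 !mul0rn !addr0. Qed.

Lemma ad_h_ad_f p : comm_ad h (comm_ad f p) = comm_ad f (comm_ad h p - p *+ 2).
Proof.
have := comm_ad_jacobi h f p; rewrite hf => J.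
rewrite -[LHS](subrK (comm_ad f (comm_ad h p))) -J comm_adB addrC; congr (_ + _).
by rewrite comm_adMn !comm_adE mulNr mulrN mulrnAl mulrnAr mulrnBl opprB opprK addrC.
Qed.

(** The Casimir operator commutes with ad(f), so it is constant along the string
    that ad(f) generates from a highest weight vector. *)
Lemma casimir_ad_f p : casimir e f (comm_ad f p) = comm_ad f (casimir e f p).
Proof.
have ef : comm_ad e (comm_ad f p) = comm_ad f (comm_ad e p) + comm_ad h p.
  by rewrite comm_ad_jacobi addrC subrK.
rewrite /casimir ef !ad_h_ad_f -!(comm_adMn f) -!(comm_adD f); congr comm_ad.
rewrite subrK comm_adB comm_adMn mulrnDl [_ *+ 4 + _]addrC.
by rewrite (mulrnDr _ 2 2) -!addrA [X in _ + (_ + X)]addrA addKr comm_adMn.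
Qed.

Lemma casimir_primitive p m : comm_ad e p = 0 -> comm_ad h p = p *+ m ->
  casimir e f p = p *+ (m * m.+2).
Proof.
move=> ep hp; rewrite /casimir ep hp comm_adMn hp comm_ad0 mul0rn addr0.
by rewrite -!mulrnA -mulrnDr -mulnDr addn2.
Qed.

Lemma casimir_primitive_iter p m k : comm_ad e p = 0 -> comm_ad h p = p *+ m ->
  casimir e f (iter k (comm_ad f) p) = iter k (comm_ad f) p *+ (m * m.+2).
Proof.
move=> ep hp; elim: k => [|k IHk] /=; first exact: casimir_primitive.
by rewrite casimir_ad_f IHk comm_adMn.
Qed.
End Casimir.

(** * Invariants of an adjoint sl(2) action *)

(** The argument is purely ring-theoretic.  [S] plays the group algebra: it is
    a source of coefficients that can be moved to the left of the [X i], and it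
    absorbs the commutators of the [Y i] with the [X j].  [U] contains [S] and
    the angular momenta, and enough scalars to divide by positive integers. *)
Section HoweDuality.
Variables (A : pzRingType) (r : nat) (X Y : 'I_r -> A) (e f : A).
Variables (U S : A -> Prop).
Local Notation h := (comm_ad e f).

Hypothesis XX : forall i j, X i * X j = X j * X i.
Hypothesis eX : forall i, comm_ad e (X i) = 0.
Hypothesis eY : forall i, comm_ad e (Y i) = X i.
Hypothesis fX : forall i, comm_ad f (X i) = Y i.
Hypothesis fY : forall i, comm_ad f (Y i) = 0.
Hypothesis hf : comm_ad h f = - (f *+ 2).

Hypotheses (U1 : U 1) (UN : forall u, U u -> U (- u)).
Hypotheses (UD : forall u v, U u -> U v -> U (u + v)).
Hypotheses (UM : forall u v, U u -> U v -> U (u * v)).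
Hypothesis Uinv : forall n, exists2 k, U k & k * n.+1%:R = 1.
Hypothesis Ue : forall u, U u -> comm_ad e u = 0.
Hypothesis Uf : forall u, U u -> comm_ad f u = 0.
Hypothesis US : forall s, S s -> U s.
Hypothesis Uang : forall i j, U (X i * Y j - X j * Y i).
Hypothesis XS : forall i s, S s ->
  exists2 t : 'I_r -> A, (forall j, S (t j)) & X i * s = \sum_j t j * X j.
Hypothesis S_YX : forall i j, S (Y i * X j - X j * Y i).
Hypothesis A_ind : forall P : A -> Prop, P 1 ->
  (forall p q, P p -> P q -> P (p + q)) ->
  (forall u p, U u -> P p -> P (u * p)) ->
  (forall p i, P p -> P (p * X i)) -> (forall p i, P p -> P (p * Y i)) ->
  (forall p s, S s -> P p -> P (p * s)) -> forall p, P p.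

(** The left [U]-span of the monomials of degree [m] in the [X i].  Sums are
    allowed at every stage, because moving an element of [S] across one [X i]
    produces a sum. *)
Inductive hw_span : nat -> A -> Prop :=
| hw_U u : U u -> hw_span 0 u
| hw_X m p i : hw_span m p -> hw_span m.+1 (p * X i)
| hw_D m p q : hw_span m p -> hw_span m q -> hw_span m (p + q)
| hw_0 m : hw_span m 0.
Local Notation HW := hw_span.

Lemma hw_UM m u p : U u -> HW m p -> HW m (u * p).
Proof.
move=> Uu; elim=> {m p} [v Uv|m p i _ IH|m p q _ IHp _ IHq|m].
- exact/hw_U/UM.
- by rewrite mulrA; apply: hw_X.
- by rewrite mulrDr; apply: hw_D.
- by rewrite mulr0; apply: hw_0.
Qed.

Lemma U0 : U 0.
Proof. by rewrite -(subrr 1); apply: UD => //; apply: UN. Qed.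

Lemma hw_sum m I (s : seq I) (F : I -> A) :
  (forall i, HW m (F i)) -> HW m (\sum_(i <- s) F i).
Proof.
move=> HF; elim/big_ind: _ => //; [exact: hw_0 | exact: hw_D].
Qed.

Lemma U_natr n : U n%:R.
Proof. by elim: n => [|n IHn]; [exact: U0 | rewrite mulrS; apply: UD]. Qed.

Lemma hwB m p q : HW m p -> HW m q -> HW m (p - q).
Proof.
move=> Hp Hq; apply: hw_D => //; rewrite -mulN1r.
by apply: hw_UM => //; apply: UN.
Qed.

Lemma hwMn m p n : HW m p -> HW m (p *+ n).
Proof. by rewrite -mulr_natl; apply/hw_UM/U_natr. Qed.

Lemma hw_S m p s : HW m p -> S s -> HW m (p * s).
Proof.
move=> Hp; elim: Hp s => {m p} [u Uu|m p i _ IH|m p q _ IHp _ IHq|m] s Ss.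
- exact/hw_U/UM/US.
- have [t St Et] := XS i Ss; rewrite -mulrA Et mulr_sumr.
  by apply: hw_sum => j; rewrite mulrA; apply/hw_X/IH.
- by rewrite mulrDl; apply: hw_D; [apply: IHp | apply: IHq].
- by rewrite mul0r; apply: hw_0.
Qed.

Local Notation ang i j := (X i * Y j - X j * Y i).

(** An angular momentum crosses [X i] up to terms in which an [X] has been
    traded for an [X] times an element of [S]. *)
Lemma hw_angular m p k l : HW m p -> HW m (p * ang k l).
Proof.
elim=> {m p} [u Uu|m p i Hp IH|m p q _ IHp _ IHq|m].
- exact/hw_U/UM.
- have -> : p * X i * ang k l = p * ang k l * X i
    + (p * X l * (Y k * X i - X i * Y k) - p * X k * (Y l * X i - X i * Y l)).
    rewrite -!mulrA -mulrBr -mulrDr; congr (p * _).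
    rewrite !mulrBr !mulrBl !mulrA (XX i k) (XX i l).
    by rewrite addrA addrA subrK opprB [RHS]addrC addrA subrK.
  by apply: hw_D; [apply: hw_X | apply: hwB; apply: hw_S => //; exact: hw_X].
- by rewrite mulrDl; apply: hw_D.
- by rewrite mul0r; apply: hw_0.
Qed.

(** The projection of V_m (x) V_1 onto V_{m-1}.  For p = q X_i the expression
    differs from the one for q, times X_i, by m q [Y_j, X_i] and by
    q (Y_i X_j - X_i Y_j), that is, by q times elements of [S] and an angular
    momentum. *)
Lemma hw_clebsch_gordan m p j : HW m p ->
  if m is m'.+1 then HW m' (comm_ad f p * X j - (p * Y j) *+ m)
  else comm_ad f p = 0.
Proof.
move=> Hp; elim: Hp j => {m p} [u Uu|m p i Hp IH|m p q _ IHp _ IHq|m] j.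
- exact: Uf.
- have -> : comm_ad f (p * X i) * X j - (p * X i * Y j) *+ m.+1
    = (comm_ad f p * X j - (p * Y j) *+ m) * X i
      + ((p * (Y j * X i - X i * Y j)) *+ m
         + (p * (Y i * X j - X j * Y i) + p * ang j i)).
    rewrite comm_adM fX mulrDl -[comm_ad f p * X i * X j]mulrA (XX i j).
    rewrite -[p * _ + p * _]mulrDr subrKA !mulrBr mulrBl mulrnAl !mulrA mulrnBl.
    by rewrite !addrA subrK -addrA addrACA -opprD -mulrSr -addrA.
  have HS : HW m (p * (Y i * X j - X j * Y i) + p * ang j i).
    by apply: hw_D; [apply: hw_S | apply: hw_angular].
  apply: hw_D; last first.
    by apply: hw_D => //; apply/hwMn/hw_S.
  case: m Hp IH {HS} => [|m] Hp IH; last exact/hw_X/IH.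
  by rewrite IH // mul0r mulr0n subr0 mul0r; apply: hw_0.
- case: m {IHp IHq} (IHp j) (IHq j) => [|m] /= IHp IHq.
    by rewrite comm_adD IHp IHq addr0.
  by rewrite comm_adD !mulrDl mulrnDl opprD addrACA; apply: hw_D.
- by rewrite comm_ad0; case: m => // m; rewrite !mul0r mul0rn subr0; apply: hw_0.
Qed.

Lemma hw_e m p : HW m p -> comm_ad e p = 0.
Proof.
elim=> {m p} [u Uu|m p i _ IH|m p q _ IHp _ IHq|m].
- exact: Ue.
- by rewrite comm_adM IH eX mul0r mulr0 addr0.
- by rewrite comm_adD IHp IHq addr0.
- exact: comm_ad0.
Qed.

Lemma hw_h m p : HW m p -> comm_ad h p = p *+ m.
Proof.
elim=> {m p} [u Uu|m p i _ IH|m p q _ IHp _ IHq|m].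
- by rewrite comm_ad_jacobi (Ue Uu) (Uf Uu) !comm_ad0 subr0.
- by rewrite comm_adM IH comm_ad_jacobi fX eX eY comm_ad0 subr0 mulrnAl -mulrSr.
- by rewrite comm_adD IHp IHq mulrnDl.
- by rewrite comm_ad0 mul0rn.
Qed.

Lemma hw0_U p : HW 0 p -> U p.
Proof.
move=> Hp; have [n n0] : {n | n = 0%N} by exists 0%N.
rewrite -{1}n0 in Hp; elim: Hp n0 => {n p} // [n p q _ IHp _ IHq n0|n _]; last exact: U0.
by apply: UD; [apply: IHp | apply: IHq].
Qed.

Local Notation "'D^' k" := (iter k (comm_ad f)) (at level 8, k at level 2).

(** The inequality is strict, so that the induction on [M] starts from zero. *)
Inductive string_span (M : nat) : A -> Prop :=
| string_gen m k p : (m < M)%N -> HW m p -> string_span M (D^k p)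
| string_0 : string_span M 0
| string_D p q : string_span M p -> string_span M q -> string_span M (p + q).

Lemma iter_ad0 k : D^k 0 = 0.
Proof. by elim: k => //= k ->; rewrite comm_ad0. Qed.

Lemma iter_adD k p q : D^k (p + q) = D^k p + D^k q.
Proof. by elim: k => //= k ->; rewrite comm_adD. Qed.

Lemma iter_adN k p : D^k (- p) = - D^k p.
Proof. by elim: k => //= k ->; rewrite comm_adN. Qed.

Lemma iter_adMn k p n : D^k (p *+ n) = D^k p *+ n.
Proof. by elim: k => //= k ->; rewrite comm_adMn. Qed.

Lemma iter_adMl k u p : comm_ad f u = 0 -> D^k (u * p) = u * D^k p.
Proof. by move=> fu; elim: k => //= k ->; rewrite comm_adM fu mul0r add0r. Qed.

Lemma iter_adMr k u p : comm_ad f u = 0 -> D^k (p * u) = D^k p * u.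
Proof. by move=> fu; elim: k => //= k ->; rewrite comm_adM fu mulr0 addr0. Qed.

Lemma iter_ad_X k p j : D^k.+1 (p * X j) = D^k.+1 p * X j + (D^k p * Y j) *+ k.+1.
Proof.
elim: k => [|k IHk]; first by rewrite /= comm_adM fX.
rewrite iterS IHk comm_adD comm_adM comm_adMn comm_adM fX fY mulr0 addr0.
by rewrite -addrA -mulrS.
Qed.

Lemma string_le M N p : (M <= N)%N -> string_span M p -> string_span N p.
Proof.
move=> MN; elim=> {p} [m k p mM Hp||p q _ IHp _ IHq].
- by apply: string_gen Hp; apply: leq_trans MN.
- exact: string_0.
- exact: string_D.
Qed.

Lemma string_UM M u p : U u -> string_span M p -> string_span M (u * p).
Proof.
move=> Uu; elim=> {p} [m k p mM Hp||p q _ IHp _ IHq].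
- by rewrite -iter_adMl ?Uf //; apply: string_gen (hw_UM Uu Hp).
- by rewrite mulr0; exact: string_0.
- by rewrite mulrDr; exact: string_D.
Qed.

Lemma stringN M p : string_span M p -> string_span M (- p).
Proof. by rewrite -mulN1r; apply/string_UM/UN. Qed.

Lemma stringMn M p n : string_span M p -> string_span M (p *+ n).
Proof. by rewrite -mulr_natl; apply/string_UM/U_natr. Qed.

(** Both D^k (p X_j) and D^k applied to the expression of [hw_clebsch_gordan]
    are combinations of D^(k+1) p X_j and D^k p Y_j; eliminating the former
    leaves m + 1 times the latter. *)
Lemma string_genY M m k p j : (m < M)%N -> HW m p -> string_span M.+1 (D^k p * Y j).
Proof.
move=> mM Hp; have [a Ua a1] := Uinv m.
rewrite -[_ * _]mul1r -a1 -mulrA; apply: string_UM => //.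
have -> : m.+1%:R * (D^k p * Y j)
    = D^k.+1 (p * X j) - D^k (comm_ad f p * X j - (p * Y j) *+ m).
  rewrite iter_adD iter_adN iter_adMn (iter_adMr _ _ (fY j)) iter_ad_X.
  rewrite mulr_natl opprD opprK addrA.
  have -> : D^k (comm_ad f p * X j) = D^k.+1 p * X j + (D^k p * Y j) *+ k.
    by case: k => [|k]; rewrite ?mulr0n ?addr0 // iter_ad_X -!iterSr.
  by rewrite opprD addrACA subrr add0r (mulrS _ k) addrK -mulrS.
apply: string_D; first by apply: string_gen (hw_X j Hp); rewrite ltnS.
apply: stringN; have := hw_clebsch_gordan j Hp; case: m mM Hp {a Ua a1} => [|m] mM Hp Hf.
  by rewrite Hf mul0r subr0 iter_ad0; apply: string_0.
by apply: string_gen Hf; rewrite ltnS; apply: leq_trans (leqnSn _) (ltnW mM).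
Qed.

Lemma string_genX M m k p j : (m < M)%N -> HW m p -> string_span M.+1 (D^k p * X j).
Proof.
move=> mM Hp; have HX : HW m.+1 (p * X j) by apply: hw_X.
case: k => [|k]; first by apply: (string_gen 0) HX; rewrite ltnS.
rewrite -[D^k.+1 p * X j](addrK ((D^k p * Y j) *+ k.+1)) -iter_ad_X.
apply: string_D; first by apply: string_gen HX; rewrite ltnS.
exact/stringN/stringMn/(string_genY _ _ mM).
Qed.

Lemma string_spans p : exists M, string_span M p.
Proof.
elim/A_ind: p.
- by exists 1%N; apply: (string_gen 0 (m := 0)) => //; apply: hw_U.
- move=> p q [M Mp] [N Nq]; exists (maxn M N); apply: string_D.
    by apply: string_le Mp; apply: leq_maxl.
  by apply: string_le Nq; apply: leq_maxr.
- by move=> u p Uu [M Mp]; exists M; apply: string_UM.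
- move=> p j [M Mp]; exists M.+1.
  elim: Mp => {p} [m k p mM Hp||p q _ IHp _ IHq].
  + exact: string_genX mM Hp.
  + by rewrite mul0r; apply: string_0.
  + by rewrite mulrDl; apply: string_D.
- move=> p j [M Mp]; exists M.+1.
  elim: Mp => {p} [m k p mM Hp||p q _ IHp _ IHq].
  + exact: string_genY mM Hp.
  + by rewrite mul0r; apply: string_0.
  + by rewrite mulrDl; apply: string_D.
- move=> p s Ss [M Mp]; exists M.
  elim: Mp => {p} [m k p mM Hp||p q _ IHp _ IHq].
  + rewrite -iter_adMr; last exact/Uf/US.
    by apply: string_gen mM _; apply: hw_S.
  + by rewrite mul0r; apply: string_0.
  + by rewrite mulrDl; apply: string_D.
Qed.

(** The factor of the Casimir operator that belongs to the highest weight [M]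
    removes the strings of that weight, and it rescales the other ones. *)
Lemma string_casimir M p : string_span M.+1 p ->
  string_span M (casimir e f p - p *+ (M * M.+2)).
Proof.
elim=> {p} [m k p mM Hp||p q _ IHp _ IHq].
- rewrite (casimir_primitive_iter hf k (hw_e Hp) (hw_h Hp)).
  move: mM; rewrite ltnS leq_eqVlt => /orP[/eqP ->|mM].
    by rewrite subrr; apply: string_0.
  have Hk n : string_span M (D^k p *+ n) by apply/stringMn/(string_gen _ mM).
  by apply: string_D => //; apply: stringN.
- by rewrite casimir0 mul0rn subr0; apply: string_0.
- by rewrite casimirD mulrnDl opprD addrACA; apply: string_D.
Qed.

(** On an invariant the Casimir operator vanishes, so that the removal of the
    strings of the highest weight only multiplies it by a nonzero integer; this
    is repeated until the strings of weight zero are left. *)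
Lemma sl2_invariants_generated p : comm_ad e p = 0 -> comm_ad f p = 0 -> U p.
Proof.
move=> ep fp; have cp : casimir e f p = 0.
  have hp : comm_ad h p = 0 by rewrite comm_ad_jacobi ep fp !comm_ad0 subr0.
  by rewrite /casimir hp ep !comm_ad0 !mul0rn !addr0.
have [M Mp] := string_spans p; elim: M p Mp cp {ep fp} => [|M IHM] p Mp cp.
  elim: Mp => {p cp} // [|p q _ ? _ ?]; [exact: U0 | exact: UD].
case: M IHM Mp => [|M] IHM Mp.
  elim: Mp => {p cp} [m k p|| p q _ ? _ ?]; [|exact: U0 | exact: UD].
  case: m => // _ Hp; case: k => [|k]; first exact: hw0_U.
  by rewrite iterSr (Uf (hw0_U Hp)) iter_ad0; exact: U0.
have Up : U (p *+ (M.+1 * M.+3)).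
  have /stringN := string_casimir Mp; rewrite cp sub0r opprK; move/IHM; apply.
  have cMn n : casimir e f (p *+ n) = 0.
    by elim: n => [|n IHn]; rewrite ?casimir0 // mulrS casimirD cp IHn addr0.
  exact: cMn.
(* [p] itself is recovered by dividing by the eigenvalue, nonzero as M > 0. *)
have [a Ua] := Uinv (M.+1 * M.+3).-1; rewrite prednK ?muln_gt0 // => a1.
by rewrite -[p]mul1r -a1 -mulrA mulr_natl; apply: UM.
Qed.

End HoweDuality.

(** * Reflections and root systems *)

Lemma mulmx_cV_inj (K : pzRingType) m n (A B : 'M[K]_(m, n)) :
  (forall v : 'cV_n, A *m v = B *m v) -> A = B.
Proof.
move=> AB; apply/matrixP => i j.
by have /colP/(_ i) := AB (delta_mx j 0); rewrite -!colE !mxE.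
Qed.

Section Reflections.
Variables (R : realType) (r : nat) (ip : {dot 'cV[R]_r for idfun}).
Local Notation E := 'cV[R]_r.
Implicit Types (a u v : E) (g : 'M[R]_r).

Lemma ipC u v : ip u v = ip v u.
Proof. by rewrite hermC /= expr0 mul1r. Qed.

Lemma ip_neq0 a : a != 0 -> ip a a != 0.
Proof. by move=> a0; rewrite gt_eqF ?neq0_dnorm_gt0. Qed.

Lemma flat_mul a v : flat ip a *m v = (ip a v)%:M.
Proof.
apply/matrixP => i j; rewrite !ord1 !mxE eqxx mulr1n {2}(matrix_sum_delta v) raddf_sum.
by apply: eq_bigr => k _ /=; rewrite big_ord1 linearZ mxE mulrC.
Qed.

Lemma flatZ k a : flat ip (k *: a) = k *: flat ip a.
Proof. by apply/rowP => j; rewrite !mxE linearZl_LR. Qed.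

Lemma flatN a : flat ip (- a) = - flat ip a.
Proof. by rewrite -scaleN1r flatZ scaleN1r. Qed.

Lemma reflection_mul a v : reflection ip a *m v = v - (2 / ip a a * ip a v) *: a.
Proof.
by rewrite /reflection mulmxBl mul1mx -mulmxA flat_mul mul_mx_scalar scalerA mulrC.
Qed.

Lemma coroot_norm a : a != 0 -> 2 / ip a a * ip a a = 2.
Proof. by move=> a0; rewrite divfK ?ip_neq0. Qed.

Lemma ip_reflection a u v :
  ip (reflection ip a *m u) (reflection ip a *m v) = ip u v.
Proof.
rewrite !reflection_mul; have [->|a0] := eqVneq a 0; first by rewrite !scaler0 !subr0.
rewrite linearBl !linearBr /= !linearZl_LR !linearZr_LR /= (ipC u a).
have := coroot_norm a0; set k := 2 / ip a a => ka.
rewrite [k * ip a v * ip a a]mulrAC ka; ring.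
Qed.

Lemma reflection_root a : a != 0 -> reflection ip a *m a = - a.
Proof.
move=> a0; rewrite reflection_mul coroot_norm // scaler_nat mulr2n.
by rewrite opprD addrA subrr sub0r.
Qed.

Lemma reflectionK a v : reflection ip a *m (reflection ip a *m v) = v.
Proof.
rewrite !reflection_mul; have [->|a0] := eqVneq a 0; first by rewrite !scaler0 !subr0.
rewrite linearBr linearZr_LR /=; have := coroot_norm a0; set k := 2 / ip a a => ka.
rewrite mulrBr [k * (_ * _)]mulrCA ka -addrA -opprD -scalerDl.
by rewrite (_ : k * ip a v + _ = 0) ?scale0r ?subr0 //; ring.
Qed.

Lemma invmx_reflection a : invmx (reflection ip a) = reflection ip a.
Proof.
have ss : reflection ip a *m reflection ip a = 1%:M.
  by apply: mulmx_cV_inj => v; rewrite -mulmxA reflectionK mul1mx.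
have /mulmx1_unit[us _] := ss.
by rewrite -[LHS]mulmx1 -ss mulKmx.
Qed.

Lemma reflectionN a : reflection ip (- a) = reflection ip a.
Proof.
apply: mulmx_cV_inj => v; rewrite !reflection_mul linearNl linearNr linearNl /=.
by rewrite opprK scalerN mulrN scaleNr opprK.
Qed.

Lemma flat_orth g a : (forall u v, ip (g *m u) (g *m v) = ip u v) ->
  flat ip (g *m a) *m g = flat ip a.
Proof. by move=> og; apply: mulmx_cV_inj => v; rewrite -mulmxA !flat_mul og. Qed.

Lemma reflection_orth g a : (forall u v, ip (g *m u) (g *m v) = ip u v) ->
  reflection ip (g *m a) *m g = g *m reflection ip a.
Proof.
move=> og; apply: mulmx_cV_inj => v.
by rewrite -!mulmxA !reflection_mul !og mulmxBr -scalemxAr.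
Qed.

End Reflections.

Section WeylGroup.
Variables (R : realType) (r : nat) (ip : {dot 'cV[R]_r for idfun}).
Variables (Phi : {fset 'cV[R]_r}).
Hypothesis hPhi : is_root_system ip Phi.
Local Notation W := (weyl_group ip Phi).
Local Notation s a := (reflection ip a).

Lemma weyl_unit (w : W) : val w \in unitmx.
Proof.
case: w => g /= /asboolP; elim=> {g} [|a _|g h _ gu _ hu|g _ gu].
- exact: unitmx1.
- suff /mulmx1_unit[] : s a *m s a = 1%:M by [].
  by apply: mulmx_cV_inj => v; rewrite -mulmxA reflectionK mul1mx.
- by rewrite unitmx_mul gu.
- by rewrite unitmx_inv.
Qed.

Lemma weyl_orth (w : W) u v : ip (val w *m u) (val w *m v) = ip u v.
Proof.
case: w => g wg /=; move: (weyl_unit (exist _ g wg)) u v => /=; move: wg => /asboolP.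
elim=> {g} [|a _|g h gW IHg hW IHh|g gW IHg] gu u v.
- by rewrite !mul1mx.
- exact: ip_reflection.
- move: gu; rewrite unitmx_mul => /andP[gu hu].
  by rewrite -!mulmxA IHg ?IHh.
- rewrite unitmx_inv in gu.
  by rewrite -[LHS]IHg // !mulKVmx.
Qed.

(** The equivalence, rather than one implication, is what passes to
    inverses. *)
Lemma weyl_root (w : W) a : (val w *m a \in Phi) = (a \in Phi).
Proof.
have [_ sPhi _] := hPhi.
case: w => g /= wg; move: (weyl_unit (exist _ g wg)) a => /=; move: wg => /asboolP.
elim=> {g} [|b bPhi|g h gW IHg hW IHh|g gW IHg] gu a.
- by rewrite mul1mx.
- by apply/idP/idP => [/(sPhi b)|/(sPhi b)]; [rewrite reflectionK; apply | apply].
- by move: gu; rewrite unitmx_mul => /andP[gu hu]; rewrite -mulmxA IHg ?IHh.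
- by rewrite unitmx_inv in gu; rewrite -[LHS]IHg // mulKVmx.
Qed.

Lemma root_neq0 (a : Phi) : val a != 0.
Proof. by have [n0 _ _] := hPhi; apply: contraNneq n0 => <-; apply: valP. Qed.

Definition weyl_act (w : W) (a : Phi) : Phi :=
  FSetSub (etrans (weyl_root w (val a)) (valP a)).

Lemma root_opp_mem (a : Phi) : - val a \in Phi.
Proof.
rewrite -(reflection_root ip (root_neq0 a)) (weyl_root (reflectionW ip a)).
exact: (valP a).
Qed.

Definition root_opp (a : Phi) : Phi := FSetSub (root_opp_mem a).

Lemma root_oppK : involutive root_opp.
Proof. by move=> a; apply: val_inj; rewrite /= opprK. Qed.

Lemma weyl_act_inj w : injective (weyl_act w).
Proof.
move=> a b /(congr1 val) /= /(congr1 (mulmx (invmx (val w)))).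
by rewrite !mulKmx ?weyl_unit // => /val_inj.
Qed.

Variable Pos : {set Phi}.
Hypothesis hPos : is_positive_system ip Pos.

Lemma pos_opp a : (root_opp a \in Pos) = (a \notin Pos).
Proof.
have [v [v0 ->]] := hPos; rewrite !inE /= linearNl oppr_gt0.
by rewrite -leNgt le_eqVlt (negPf (v0 a)).
Qed.

(** The element [w] need not preserve the positive roots, but for an even
    function both sides are half of the sum over all roots, which [w]
    permutes. *)
Lemma pos_sum_weyl (K : numFieldType) (V : lmodType K) (F : Phi -> V) (w : W) :
  (forall a, F (root_opp a) = F a) ->
  \sum_(a in Pos) F (weyl_act w a) = \sum_(a in Pos) F a.
Proof.
have half (G : Phi -> V) : (forall a, G (root_opp a) = G a) ->
    \sum_(a in Pos) G a = 2^-1 *: \sum_a G a.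
  move=> Gopp; rewrite [in RHS](bigID (fun a => a \in Pos)) /=.
  have -> : \sum_(a | a \notin Pos) G a = \sum_(a in Pos) G a.
    rewrite (reindex_inj (inv_inj root_oppK)) /=.
    by apply: eq_big => a; rewrite ?pos_opp ?negbK.
  by rewrite -mulr2n -scaler_nat scalerA mulVf ?scale1r ?pnatr_eq0.
move=> Fopp; rewrite half => [|a].
  by rewrite [RHS]half // [in RHS](reindex_inj (@weyl_act_inj w)).
rewrite -[RHS]Fopp; congr F; apply: val_inj; exact: mulmxN.
Qed.

End WeylGroup.

(** * Linear substitutions and divided differences of polynomials *)

Import mpoly.

HB.lock Definition lin_form (K : fieldType) r (x : 'rV[K]_r) : {mpoly K[r]} :=
  \sum_i x 0 i *: 'X_i.

(** Polynomials are functions of a column vector v, linear forms being rows; the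
    substitution is then p(v) |-> p(g v), so that it reverses products
    ([lin_substM]). *)
HB.lock Definition lin_subst (K : fieldType) r (g : 'M[K]_r)
    (p : {mpoly K[r]}) : {mpoly K[r]} :=
  p \mPo [tuple lin_form (row i g) | i < r].

HB.lock Definition dir_deriv (K : fieldType) r (y : 'cV[K]_r)
    (p : {mpoly K[r]}) : {mpoly K[r]} :=
  \sum_i y i 0 *: p^`M(i).

(** The quotient of p - g p by the linear form [x], with default value 0 when the
    division is not exact; it is exact when g is the reflection whose mirror is
    the kernel of [x] ([div_diff_ex]). *)
HB.lock Definition div_diff (K : fieldType) r (g : 'M[K]_r) (x : 'rV[K]_r)
    (p : {mpoly K[r]}) : {mpoly K[r]} :=
  if pselect (exists q, lin_form x * q = p - lin_subst g p) is left h
  then sval (cid h) else 0.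

Section Polynomials.
Variables (K : fieldType) (r : nat).
Local Notation P := {mpoly K[r]}.
Implicit Types (p q : P) (x : 'rV[K]_r) (y : 'cV[K]_r) (g : 'M[K]_r).

Lemma lin_formE x : lin_form x = \sum_i x 0 i *: 'X_i.
Proof. by rewrite lin_form.unlock. Qed.

Lemma lin_substE g p : lin_subst g p = p \mPo [tuple lin_form (row i g) | i < r].
Proof. by rewrite lin_subst.unlock. Qed.

Lemma dir_derivE y p : dir_deriv y p = \sum_i y i 0 *: p^`M(i).
Proof. by rewrite dir_deriv.unlock. Qed.

Lemma div_diffP g x p : (exists q, lin_form x * q = p - lin_subst g p) ->
  lin_form x * div_diff g x p = p - lin_subst g p.
Proof. by move=> h; rewrite div_diff.unlock; case: pselect => // h'; case: cid. Qed.

Fact lin_form_is_linear : linear (@lin_form K r).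
Proof.
move=> k u v; rewrite !lin_formE scaler_sumr -big_split; apply: eq_bigr => i _ /=.
by rewrite !mxE scalerDl scalerA.
Qed.
HB.instance Definition _ :=
  GRing.isLinear.Build K 'rV[K]_r P *:%R (@lin_form K r) lin_form_is_linear.

Lemma lin_form_eq0 x : lin_form x = 0 -> x = 0.
Proof.
move=> x0; apply/rowP => j; rewrite mxE.
have := congr1 (mcoeff U_(j)) x0; rewrite mcoeff0 lin_formE raddf_sum => <-.
rewrite (bigD1 j) //= mcoeffZ mcoeffXU eqxx mulr1 big1 ?addr0 // => i /negPf ij.
by rewrite mcoeffZ mcoeffXU ij mulr0.
Qed.

Lemma mpoly_lin_ind (Q : P -> Prop) : Q 1 ->
  (forall a p q, Q p -> Q q -> Q (a *: p + q)) ->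
  (forall x p, Q p -> Q (lin_form x * p)) -> forall p, Q p.
Proof.
move=> Q1 Qlin QM p.
have QX i q : Q q -> Q ('X_i * q).
  suff -> : 'X_i = lin_form (delta_mx 0 i : 'rV[K]_r) by apply: QM.
  rewrite lin_formE (bigD1 i) //= mxE !eqxx scale1r big1 ?addr0 // => j /negPf ji.
  by rewrite mxE ji andbF scale0r.
elim/mpolyind: p => [|a m p _ _ Qp].
  by have := Qlin (-1) 1 1 Q1 Q1; rewrite scaleN1r addNr.
apply: Qlin => //; rewrite mpolyXE_id; elim/big_rec: _ => // i q _ Qq.
elim: (m i) => [|n IHn]; first by rewrite expr0 mul1r.
by rewrite exprS -mulrA; apply: QX.
Qed.

Fact lin_subst_is_linear g : linear (lin_subst g).
Proof. by move=> k p q; rewrite !lin_substE linearP. Qed.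
HB.instance Definition _ g :=
  GRing.isLinear.Build K P P *:%R (lin_subst g) (lin_subst_is_linear g).

Fact lin_subst_is_monoid_morphism g : monoid_morphism (lin_subst g).
Proof. by split=> [|p q]; rewrite !lin_substE ?rmorph1 ?rmorphM. Qed.
HB.instance Definition _ g :=
  GRing.isMonoidMorphism.Build P P (lin_subst g) (lin_subst_is_monoid_morphism g).

Lemma lin_subst_form g x : lin_subst g (lin_form x) = lin_form (x *m g).
Proof.
rewrite {1}lin_formE linear_sum mulmx_sum_row linear_sum; apply: eq_bigr => i _ /=.
by rewrite !linearZ /= lin_substE comp_mpolyXU -tnth_nth tnth_mktuple.
Qed.

Lemma lin_subst1 p : lin_subst 1%:M p = p.
Proof.
elim/mpoly_lin_ind: p => [|a p q Ip Iq|x p Ip]; first exact: rmorph1.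
- by rewrite linearP /= Ip Iq.
- by rewrite rmorphM /= lin_subst_form mulmx1 Ip.
Qed.

Lemma lin_substM g h p : lin_subst g (lin_subst h p) = lin_subst (h *m g) p.
Proof.
elim/mpoly_lin_ind: p => [|a p q Ip Iq|x p Ip]; first by rewrite !rmorph1.
- by rewrite !linearP /= Ip Iq.
- by rewrite !rmorphM /= !lin_subst_form -mulmxA Ip.
Qed.

Fact dir_deriv_is_linear y : linear (dir_deriv y).
Proof.
move=> k p q; rewrite !dir_derivE scaler_sumr -big_split; apply: eq_bigr => i _ /=.
by rewrite linearP scalerDr !scalerA mulrC.
Qed.
HB.instance Definition _ y :=
  GRing.isLinear.Build K P P *:%R (dir_deriv y) (dir_deriv_is_linear y).

Lemma dir_deriv_linl k u v p :
  dir_deriv (k *: u + v) p = k *: dir_deriv u p + dir_deriv v p.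
Proof.
rewrite !dir_derivE scaler_sumr -big_split; apply: eq_bigr => i _ /=.
by rewrite !mxE scalerDl scalerA.
Qed.

Lemma dir_deriv1 y : dir_deriv y 1 = 0.
Proof. by rewrite !dir_derivE big1 // => i _; rewrite -mpolyC1 mderivC scaler0. Qed.

Lemma dir_deriv_form y x p :
  dir_deriv y (lin_form x * p) = lin_form x * dir_deriv y p + (x *m y) 0 0 *: p.
Proof.
rewrite !dir_derivE mulr_sumr mxE scaler_suml -big_split; apply: eq_bigr => i _ /=.
rewrite mderivM scalerDr [RHS]addrC; congr (_ + _); last exact: scalerAr.
rewrite [x 0 i * _]mulrC -scalerA -(mul_mpolyC (x 0 i)); congr (_ *: (_ * _)).
rewrite lin_formE linear_sum (bigD1 i) //= linearZ /= big1 => [|j /negPf ji].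
  rewrite addr0 mderivX mnm1E eqxx scale1r -[RHS]mulr1 mul_mpolyC -(mpolyX0 _ K).
  by congr (_ *: 'X_[_]); apply/mnmP => k; rewrite mnmBE subnn mnm0E.
by rewrite linearZ /= mderivX mnm1E ji scale0r scaler0.
Qed.

(** The chain rule for a linear change of variables. *)
Lemma dir_deriv_subst g y p :
  lin_subst g (dir_deriv (g *m y) p) = dir_deriv y (lin_subst g p).
Proof.
elim/mpoly_lin_ind: p => [|a p q Ip Iq|x p Ip].
- by rewrite rmorph1 !dir_deriv1 raddf0.
- by rewrite !linearP /= Ip Iq.
- rewrite rmorphM /= lin_subst_form !dir_deriv_form raddfD /= rmorphM /= Ip.
  by rewrite lin_subst_form linearZ /= mulmxA.
Qed.

End Polynomials.

(** * Dunkl operators *)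

HB.lock Definition dunkl (K : fieldType) r (I : finType) (A : {pred I}) (c : I -> K)
    (g : I -> 'M[K]_r) (x : I -> 'rV[K]_r) (y : 'cV[K]_r)
    (p : {mpoly K[r]}) : {mpoly K[r]} :=
  dir_deriv y p - \sum_(a in A) (c a * (x a *m y) 0 0) *: div_diff (g a) (x a) p.

(** The coefficients lie in an arbitrary field of characteristic zero containing
    the reals. *)
Section Dunkl.
Variables (R : realType) (r : nat) (ip : {dot 'cV[R]_r for idfun}).
Variables (Phi : {fset 'cV[R]_r}) (Pos : {set Phi}).
Variables (K : numFieldType) (emb : {rmorphism R -> K}) (c : Phi -> K).
Hypotheses (hPhi : is_root_system ip Phi) (hPos : is_positive_system ip Pos).
Hypothesis cW : forall (w : weyl_group ip Phi) (a b : Phi),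
  val b = val w *m val a -> c b = c a.
Local Notation W := (weyl_group ip Phi).
Local Notation P := {mpoly K[r]}.
Local Notation cx := (map_mx emb).
Local Notation pairing x y := ((x *m y) 0 0).
Implicit Types (a : Phi) (w : W) (x : 'rV[K]_r) (y : 'cV[K]_r) (p q : P).

Local Notation fl a := (cx (flat ip (val a))).
Local Notation co a := (cx (coroot ip (val a))).
Local Notation alpha a := (lin_form (fl a)).
Local Notation refl a := (lin_subst (cx (reflection ip (val a)))).

Lemma pairing_linr k x y y' : pairing x (k *: y + y') = k * pairing x y + pairing x y'.
Proof. by rewrite mulmxDr -scalemxAr mxE [X in X + _]mxE. Qed.

Lemma mulmx_refl x a : x *m cx (reflection ip (val a)) = x - pairing x (co a) *: fl a.
Proof.
rewrite map_mxB map_mx1 map_mxM mulmxBr mulmx1 mulmxA.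
by rewrite {1}[x *m co a]mx11_scalar mul_scalar_mx.
Qed.

Lemma refl_mul_cx y a : cx (reflection ip (val a)) *m y = y - pairing (fl a) y *: co a.
Proof.
rewrite map_mxB map_mx1 map_mxM mulmxBl mul1mx -mulmxA.
by rewrite {1}[fl a *m y]mx11_scalar mul_mx_scalar.
Qed.

Lemma alpha_neq0 a : alpha a != 0.
Proof.
apply/eqP => /lin_form_eq0 /eqP; rewrite map_mx_eq0 => /eqP f0.
have /eqP := root_neq0 hPhi a; apply.
have := flat_mul ip (val a) (val a); rewrite f0 mul0mx => /matrixP/(_ 0 0).
rewrite !mxE mulr1n => /esym/eqP a0; apply/eqP; apply: contraTT a0 => a0.
exact: ip_neq0.
Qed.

Lemma refl_form a x p :
  refl a (lin_form x * p) =
  lin_form x * refl a p - pairing x (co a) *: (alpha a * refl a p).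
Proof.
by rewrite rmorphM /= lin_subst_form mulmx_refl linearB linearZ /= mulrBl scalerAl.
Qed.

(** Divisibility is inherited by products with linear forms, because s x - x is a
    multiple of the root. *)
Lemma div_diff_ex a p : exists q, p - refl a p = alpha a * q.
Proof.
elim/mpoly_lin_ind: p => [|k p q [p' Ep] [q' Eq]|x p [p' Ep]].
- by exists 0; rewrite rmorph1 subrr mulr0.
- exists (k *: p' + q'); rewrite linearP /= mulrDr -scalerAr -Ep -Eq.
  by rewrite scalerBr opprD addrACA.
- exists (lin_form x * p' + pairing x (co a) *: refl a p).
  rewrite refl_form opprB addrCA -mulrBr Ep mulrCA addrC mulrDr; congr (_ + _).
  exact: scalerAr.
Qed.

Local Notation D a p := (div_diff (cx (reflection ip (val a))) (fl a) p).

Lemma div_diffE a p : alpha a * D a p = p - refl a p.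
Proof. by apply: div_diffP; have [q Eq] := div_diff_ex a p; exists q. Qed.

Lemma div_diff_unique a p q : alpha a * q = p - refl a p -> D a p = q.
Proof. by rewrite -div_diffE => /(mulfI (alpha_neq0 a)). Qed.

Lemma div_diff1 a : D a 1 = 0.
Proof. by apply: div_diff_unique; rewrite rmorph1 subrr mulr0. Qed.

Lemma div_diff_lin a k p q : D a (k *: p + q) = k *: D a p + D a q.
Proof.
apply: div_diff_unique; move: (div_diffE a p) (div_diffE a q).
move: (D a p) (D a q) => p' q' Ep Eq.
by rewrite linearP /= mulrDr -scalerAr Ep Eq scalerBr opprD addrACA.
Qed.

Lemma div_diff_form a x p : D a (lin_form x * p) =
  lin_form x * D a p + pairing x (co a) *: refl a p.
Proof.
apply: div_diff_unique; rewrite refl_form opprB mulrDr mulrCA div_diffE mulrBr.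
rewrite -[LHS]addrA; congr (_ + _); rewrite addrC; congr (_ - _).
exact/esym/scalerAr.
Qed.

Lemma div_diff_opp a p : D (root_opp hPhi a) p = - D a p.
Proof.
apply: div_diff_unique; rewrite /= reflectionN flatN map_mxN linearN /=.
by rewrite mulrNN div_diffE.
Qed.

Local Notation weyl_poly w := (lin_subst (cx (invmx (val w)))).

Lemma cx_invK w : cx (invmx (val w)) *m cx (val w) = 1%:M.
Proof. by rewrite -map_mxM mulVmx ?weyl_unit // map_mx1. Qed.

Lemma weyl_poly_form w x : weyl_poly w (lin_form x) = lin_form (x *m cx (invmx (val w))).
Proof. exact: lin_subst_form. Qed.

Lemma flat_weyl w a : fl (weyl_act hPhi w a) = fl a *m cx (invmx (val w)).
Proof.
rewrite -map_mxM /=; congr map_mx.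
by rewrite -(flat_orth (val a) (weyl_orth w)) mulmxK ?weyl_unit.
Qed.

Lemma refl_weyl w a p :
  refl (weyl_act hPhi w a) (weyl_poly w p) = weyl_poly w (refl a p).
Proof.
rewrite !lin_substM -!map_mxM; congr (lin_subst (map_mx _ _) p).
have := reflection_orth (val a) (weyl_orth w) => /(congr1 (mulmx (invmx (val w)))).
move/(congr1 (mulmx^~ (invmx (val w)))); rewrite mulKmx ?weyl_unit //.
by rewrite -!mulmxA mulmxV ?weyl_unit // mulmx1.
Qed.

(** Uniqueness of the quotient turns the conjugation rule for reflections into
    the equivariance of the divided differences. *)
Lemma div_diff_weyl w a p :
  D (weyl_act hPhi w a) (weyl_poly w p) = weyl_poly w (D a p).
Proof.
apply: div_diff_unique; rewrite flat_weyl -(weyl_poly_form w) -rmorphM /=.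
rewrite div_diffE raddfB; congr (_ - _); exact/esym/refl_weyl.
Qed.

Lemma cW_opp a : c (root_opp hPhi a) = c a.
Proof.
apply: (cW (w := reflectionW ip a)); exact/esym/reflection_root/(root_neq0 hPhi).
Qed.

Local Notation T :=
  (dunkl (mem Pos) c (fun a : Phi => cx (reflection ip (val a))) (fun a : Phi => fl a)).

Lemma dunklE y p : T y p = dir_deriv y p
  - \sum_(a in Pos) (c a * pairing (fl a) y) *: D a p.
Proof. by rewrite dunkl.unlock. Qed.

Lemma dunkl1 y : T y 1 = 0.
Proof.
by rewrite !dunklE dir_deriv1 big1 ?subrr // => a _; rewrite div_diff1 scaler0.
Qed.

Lemma dunkl_lin y k p q : T y (k *: p + q) = k *: T y p + T y q.
Proof.
rewrite !dunklE linearP /= scalerBr addrACA -opprD.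
rewrite [k *: (\sum_(a in Pos) _)]scaler_sumr.
rewrite -[in RHS]big_split /=.
congr (_ - _); apply: eq_bigr => a _.
by rewrite div_diff_lin scalerDr !scalerA [k * _]mulrC.
Qed.

Lemma dunkl_linl k y y' p : T (k *: y + y') p = k *: T y p + T y' p.
Proof.
rewrite !dunklE dir_deriv_linl scalerBr addrACA -opprD.
rewrite [k *: (\sum_(a in Pos) _)]scaler_sumr.
rewrite -[in RHS]big_split /=.
congr (_ - _); apply: eq_bigr => a _.
by rewrite pairing_linr mulrDr scalerDl scalerA mulrCA.
Qed.

(** The commutation relation of y and x in the Cherednik algebra, as an identity
    of operators on polynomials. *)
Lemma dunkl_form y x p : T y (lin_form x * p) = lin_form x * T y p
  + (pairing x y *: p
     - \sum_(a in Pos) (c a * pairing (fl a) y * pairing x (co a)) *: refl a p).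
Proof.
rewrite !dunklE dir_deriv_form mulrBr addrACA -opprD.
rewrite [lin_form x * (\sum_(a in Pos) _)]mulr_sumr -[in RHS]big_split /=.
congr (_ - _); apply: eq_bigr => a _.
by rewrite div_diff_form scalerDr scalerA scalerAr.
Qed.

Lemma pairing_flat_weyl w a y :
  pairing (fl (weyl_act hPhi w a)) (cx (val w) *m y) = pairing (fl a) y.
Proof. by rewrite flat_weyl -mulmxA [_ *m (_ *m y)]mulmxA cx_invK mul1mx. Qed.

(** The sum over positive roots is reindexed by [pos_sum_weyl]: its terms are even
    in the root, since the divided difference and the coefficient of a root
    both change sign. *)
Lemma dunkl_weyl w y p :
  weyl_poly w (T y p) = T (cx (val w) *m y) (weyl_poly w p).
Proof.
rewrite !dunklE raddfB /=; congr (_ - _).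
  have := dir_deriv_subst (cx (invmx (val w))) (cx (val w) *m y) p.
  by rewrite mulmxA cx_invK mul1mx.
rewrite linear_sum /=.
rewrite -[RHS](pos_sum_weyl (hPhi := hPhi) hPos (F := fun a =>
   (c a * pairing (fl a) (cx (val w) *m y)) *: D a (weyl_poly w p)) w) => [|a].
  apply: eq_bigr => a _; rewrite linearZ_LR; congr (_ *: _); last first.
    exact/esym/div_diff_weyl.
  by congr (_ * _); [exact/esym/cW | exact/esym/pairing_flat_weyl].
rewrite div_diff_opp cW_opp flatN map_mxN.
by rewrite mulNmx mxE mulrN scaleNr scalerN opprK.
Qed.

Lemma dunkl_form_weyl w y x p : weyl_poly w (T y p + lin_form x * p) =
  T (cx (val w) *m y) (weyl_poly w p)
  + lin_form (x *m cx (invmx (val w))) * weyl_poly w p.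
Proof. by rewrite raddfD -dunkl_weyl /= rmorphM /= lin_subst_form. Qed.

Lemma dunkl_refl a y p :
  refl a (T y p) = T (y - pairing (fl a) y *: co a) (refl a p).
Proof.
have rE q : refl a q = weyl_poly (reflectionW ip a) q by rewrite /= invmx_reflection.
by rewrite !rE dunkl_weyl /= refl_mul_cx.
Qed.

Lemma dunkl0 y : T y 0 = 0.
Proof. by have := dunkl_lin y (-1) 0 0; rewrite !scaleN1r !addNr. Qed.

Lemma dunklD y p q : T y (p + q) = T y p + T y q.
Proof. by have := dunkl_lin y 1 p q; rewrite !scale1r. Qed.

Lemma dunklZ y k p : T y (k *: p) = k *: T y p.
Proof. by have := dunkl_lin y k p 0; rewrite dunkl0 !addr0. Qed.

Lemma dunkl_sum y (J : Type) (s : seq J) (Q : pred J) (k : J -> K) (G : J -> P) :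
  T y (\sum_(j <- s | Q j) k j *: G j) = \sum_(j <- s | Q j) k j *: T y (G j).
Proof.
elim: s => [|j s IHs]; first by rewrite !big_nil dunkl0.
by rewrite !big_cons; case: ifP => // _; rewrite dunkl_lin IHs.
Qed.

(** Induction on the number of linear factors.  By the Jacobi identity the
    commutator of the two operators commutes with multiplication by x once the
    terms produced by [dunkl_form] are symmetric in y and y'; they are, because
    conjugation by the reflection in the root a subtracts from y' the multiple
    (a, y') of the coroot, which contributes (a, y) (a, y'). *)
Lemma dunklC y y' p : T y (T y' p) = T y' (T y p).
Proof.
elim/mpoly_lin_ind: p => [|k p q Ip Iq|x p Ip].
- by rewrite !dunkl1 !dunkl0.
- rewrite (dunkl_lin y' k p q) (dunkl_lin y k p q) (dunkl_lin y k) (dunkl_lin y' k).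
  by rewrite Ip Iq.
have dunklB z q q' : T z (q - q') = T z q - T z q'.
  by rewrite -scaleN1r dunklD dunklZ scaleN1r.
have expand z z' : T z (T z' (lin_form x * p)) = lin_form x * T z (T z' p)
   + ((pairing x z *: T z' p + pairing x z' *: T z p)
     - \sum_(a in Pos) (c a * pairing x (co a)) *: (
         pairing (fl a) z *: T z' (refl a p) + pairing (fl a) z' *: T z (refl a p)
         - (pairing (fl a) z * pairing (fl a) z') *: T (co a) (refl a p))).
  rewrite dunkl_form dunklD dunkl_form dunklB dunklZ dunkl_sum -!addrA; congr (_ + _).
  rewrite [RHS]addrA addrA addrA -!addrA; congr (_ + _).
  rewrite addrC -!addrA; congr (_ + _). rewrite -opprD; congr (- _).
  rewrite -big_split /=; apply: eq_bigr => a _.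
  have dl u k v q : T (u - k *: v) q = T u q - k *: T v q.
    by rewrite addrC -scaleNr dunkl_linl scaleNr addrC.
  rewrite dunkl_refl dl !scalerBr scalerDr !scalerA addrAC.
  move: (refl a p) => q; move: (T z q) (T z' q) (T (co a) q) => u v t.
  by rewrite [LHS]addrC /=; congr (_ *: _ - _ *: _ + _ *: _); ring.
rewrite !expand Ip; congr (_ + (_ - _)); first exact: addrC.
by apply: eq_bigr => a _; congr (_ *: (_ - _ *: _)); [exact: addrC | exact: mulrC].
Qed.

End Dunkl.

(** * The polynomial representation of the Cherednik algebra *)

Lemma invmx_mul (K : comUnitRingType) n (A B : 'M[K]_n) : A \in unitmx -> B \in unitmx ->
  invmx (A *m B) = invmx B *m invmx A.
Proof.
move=> uA uB; have uAB : A *m B \in unitmx by rewrite unitmx_mul uA.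
have AB1 : A *m B *m (invmx B *m invmx A) = 1%:M by rewrite mulmxA mulmxK // mulmxV.
by rewrite -[RHS]mul1mx -(mulVmx uAB) -[RHS]mulmxA AB1 mulmx1.
Qed.

Section DunklRepresentation.
Variables (R : realType) (r : nat) (ip : {dot 'cV[R]_r for idfun}).
Variables (Phi : {fset 'cV[R]_r}) (Pos : {set Phi}) (c : Phi -> R[i]).
Hypotheses (hPhi : is_root_system ip Phi) (hPos : is_positive_system ip Pos).
Hypothesis hc : W_invariant ip c.
Local Notation C := R[i].
Local Notation W := (weyl_group ip Phi).
Local Notation P := {mpoly C[r]}.
Local Notation cx := (map_mx (real_complex R)).
Local Notation T := (dunkl (mem Pos) c
  (fun a : Phi => cx (reflection ip (val a))) (fun a : Phi => cx (flat ip (val a)))).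

(** A group element acts by (w p)(v) = p(w^-1 v), hence the inverse. *)
Definition letter_op (l : smash_letter ip Phi) (p : P) : P :=
  match l with
  | inl u => T u.1 p + lin_form u.2 * p
  | inr w => lin_subst (cx (invmx (val w))) p
  end.

Fact letter_op_lin l k p q :
  letter_op l (k *: p + q) = k *: letter_op l p + letter_op l q.
Proof.
case: l => [[y x]|w] /=; last exact: linearP.
by rewrite (dunkl_lin _ _ _ hPhi) mulrDr -scalerAr scalerDr addrACA.
Qed.

Local Notation F := (free_algebra C (smash_letter ip Phi)).
Definition free_op : F -> P -> P := free_act letter_op.

Lemma free_op_rel u v : smash_rel u v -> forall p, free_op u p = free_op v p.
Proof.
have vecE (z : hh R r) p : free_op (free_vec ip Phi z) p = T z.1 p + lin_form z.2 * p.
  exact: free_act_gen.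
have grpE (w : W) p : free_op (free_grp w) p = lin_subst (cx (invmx (val w))) p.
  exact: free_act_gen.
have opM : forall a b p, free_op (a * b) p = free_op a (free_op b p).
  exact: free_actM letter_op_lin.
case=> [k z z'|w w1|w1 w2 w3 w123|w z] p.
- rewrite vecE [RHS]free_act_lin -!/(free_op _ p) !vecE /=.
  rewrite (dunkl_linl ip Pos _ c) linearP /= mulrDl -scalerAl scalerDr.
  exact: addrACA.
- by rewrite grpE w1 invmx1 map_mx1 lin_subst1 [RHS]free_act1.
- rewrite opM !grpE lin_substM w123 -map_mxM; congr (lin_subst (map_mx _ _) p).
  by rewrite (invmx_mul (weyl_unit w1) (weyl_unit w2)).
- apply: etrans (opM _ _ _) _; apply: etrans (grpE w _) _.
  apply: etrans (congr1 _ (vecE z p)) _; apply/esym.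
  apply: etrans (opM _ _ _) _; apply: etrans (vecE _ _) _.
  by rewrite (grpE w p) (dunkl_form_weyl _ hPhi hPos hc).
Qed.

Fact free_op_lin a u v p : free_op (a *: u + v) p = a *: free_op u p + free_op v p.
Proof. exact: free_act_lin. Qed.

Fact free_op_linr u a p q : free_op u (a *: p + q) = a *: free_op u p + free_op u q.
Proof. exact: free_act_linr letter_op_lin _ _ _ _. Qed.

Fact free_opM u v p : free_op (u * v) p = free_op u (free_op v p).
Proof. exact: free_actM letter_op_lin _ _ _. Qed.

Definition smash_op : smash ip Phi -> P -> P := quot_act free_op.

Lemma smash_opE u p : smash_op (quot_pi _ u) p = free_op u p.
Proof. exact: quot_actE free_op_lin free_op_linr free_opM free_op_rel _ _. Qed.

Lemma smash_op_y y p : smash_op (smash_y ip Phi y) p = T y p.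
Proof.
rewrite smash_opE [LHS](free_act_gen letter_op) /= linear0 mul0r.
exact: addr0.
Qed.

Lemma smash_op_x x p : smash_op (smash_x ip Phi x) p = lin_form x * p.
Proof.
rewrite smash_opE [LHS](free_act_gen letter_op) /=.
have := dunkl_linl ip Pos (real_complex R) c (-1) 0 0 p.
rewrite scaleN1r scaleN1r !addNr => ->; exact: add0r.
Qed.

Lemma smash_op_w w p : smash_op (smash_w w) p = lin_subst (cx (invmx (val w))) p.
Proof. by rewrite smash_opE [LHS](free_act_gen letter_op). Qed.

Fact smash_op_lin a u v p : smash_op (a *: u + v) p = a *: smash_op u p + smash_op v p.
Proof.
have [[u' ->] [v' ->]] := conj (quot_pi_surj u) (quot_pi_surj v).
by rewrite -linearP !smash_opE free_op_lin.
Qed.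

Fact smash_op_linr u a p q : smash_op u (a *: p + q) = a *: smash_op u p + smash_op u q.
Proof. by have [u' ->] := quot_pi_surj u; rewrite !smash_opE free_op_linr. Qed.

Fact smash_opM u v p : smash_op (u * v) p = smash_op u (smash_op v p).
Proof.
have [[u' ->] [v' ->]] := conj (quot_pi_surj u) (quot_pi_surj v).
by rewrite -rmorphM !smash_opE free_opM.
Qed.

Lemma smash_op0 p : smash_op 0 p = 0.
Proof. by have := smash_op_lin (-1) 0 0 p; rewrite !scaleN1r !addNr. Qed.

Lemma smash_opB u v p : smash_op (u - v) p = smash_op u p - smash_op v p.
Proof. by have := smash_op_lin (-1) v u p; rewrite !scaleN1r ![- _ + _]addrC. Qed.

Lemma smash_opZ k u p : smash_op (k *: u) p = k *: smash_op u p.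
Proof. by have := smash_op_lin k u 0 p; rewrite smash_op0 !addr0. Qed.

Lemma smash_op1 p : smash_op 1 p = p.
Proof. by have := smash_opE 1 p; rewrite rmorph1 => ->; apply: free_act1. Qed.

Lemma smash_op_sum (k : Phi -> C) (u : Phi -> smash ip Phi) p :
  smash_op (\sum_(a in Pos) k a *: u a) p = \sum_(a in Pos) k a *: smash_op (u a) p.
Proof.
rewrite (big_morph (smash_op^~ p) (id1 := 0) (op1 := +%R)).
- by apply: eq_bigr => a _; rewrite smash_opZ.
- by move=> v w; have := smash_op_lin 1 v w p; rewrite !scale1r.
- exact: smash_op0.
Qed.

Lemma smash_op_rel u v : cherednik_rel Pos c u v -> forall p, smash_op u p = smash_op v p.
Proof.
case=> [y y'|x x'|y x] p; rewrite smash_opB !smash_opM.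
- rewrite !smash_op_y smash_op0 (dunklC _ hPhi hPos hc); exact: subrr.
- rewrite !smash_op_x smash_op0 mulrCA; exact: subrr.
- rewrite smash_op_y !smash_op_x smash_op_y smash_opB smash_opZ smash_op1 smash_op_sum.
  rewrite (dunkl_form _ _ _ hPhi) [LHS]addrC addKr; congr (_ - _).
  apply: eq_bigr => a _; rewrite smash_op_w /= invmx_reflection; reflexivity.
Qed.

(** In the polynomial representation the image of 1 under x is the linear form
    x. *)
Lemma cher_x_eq0 x : cher_x ip Pos c x = 0 -> x = 0.
Proof.
move=> x0.
have opE : forall u p,
    quot_act (rel := cherednik_rel Pos c) smash_op (quot_pi _ u) p = smash_op u p.
  exact: quot_actE smash_op_lin smash_op_linr smash_opM smash_op_rel.
have := opE (smash_x ip Phi (complexify x)) 1.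
have := opE 0 1; rewrite rmorph0 -x0 => ->; rewrite smash_op_x mulr1.
have -> : smash_op 0 1 = 0.
  by have := smash_op_lin (-1) 0 0 1; rewrite !scaleN1r !addNr.
move=> /esym/lin_form_eq0/eqP; rewrite map_mx_eq0 => /eqP; exact.
Qed.

End DunklRepresentation.

(** * Commutators and generated subalgebras in quotients *)

(** A quotient algebra may be zero and so is only a ring with a compatible
    module structure; the compatibility is used through [quot_scalerAl] and
    [quot_scalerAr]. *)
Section QuotientCommutators.
Variables (K : comNzRingType) (A : algType K) (rel : A -> A -> Prop).
Local Notation Q := (quot_algebra rel).
Implicit Types (k : K) (p q u : Q).

Lemma comm_adZ u k p : comm_ad u (k *: p) = k *: comm_ad u p.
Proof. by rewrite !comm_adE scalerBr -quot_scalerAr -quot_scalerAl. Qed.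

Lemma comm_adZl u k p : comm_ad (k *: u) p = k *: comm_ad u p.
Proof. by rewrite !comm_adE scalerBr -quot_scalerAl -quot_scalerAr. Qed.

Lemma quot_pi_lin_comb k (I : finType) (S : {pred I}) (a : I -> K) (v : I -> A) :
  quot_pi rel (k%:A - \sum_(i in S) a i *: v i) =
  k *: (1 : Q) - \sum_(i in S) a i *: quot_pi rel (v i).
Proof.
rewrite linearB linearZ rmorph1 linear_sum; congr (_ - _).
by apply: eq_bigr => i _; rewrite linearZ.
Qed.

Variable S : Q -> Prop.
Local Notation U := (generated_subalgebra S).

Lemma gen_subalg0 : U 0.
Proof.
rewrite -(addNr 1) -scaleN1r; apply: gen_subalg_lin; exact: gen_subalg_1.
Qed.

Lemma gen_subalgZ k p : U p -> U (k *: p).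
Proof.
by move=> Up; rewrite -[_ *: _]addr0; apply: gen_subalg_lin Up gen_subalg0.
Qed.

Lemma gen_subalgD p q : U p -> U q -> U (p + q).
Proof. by move=> Up Uq; rewrite -[p]scale1r; apply: gen_subalg_lin. Qed.

Lemma gen_subalgN p : U p -> U (- p).
Proof. by rewrite -scaleN1r; exact: gen_subalgZ. Qed.

End QuotientCommutators.

(** * Relations in the Cherednik algebra *)

Section Cherednik.
Variables (R : realType) (r : nat) (ip : {dot 'cV[R]_r for idfun}).
Variables (Phi : {fset 'cV[R]_r}) (Pos : {set Phi}) (c : Phi -> R[i]).
Local Notation C := R[i].
Local Notation E := 'cV[R]_r.
Local Notation W := (weyl_group ip Phi).
Local Notation A := (cherednik ip Pos c).
Local Notation cw := (@cher_w R r ip Phi Pos c).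
Local Notation X := (@cher_x R r ip Phi Pos c).
Local Notation Y := (@cher_y R r ip Phi Pos c).
Local Notation "k %:RC" := (real_complex R k) (at level 2).
Local Notation pi u :=
  (quot_pi (cherednik_rel Pos c) (quot_pi (@smash_rel R r ip Phi) u)).

Lemma pi_vec_lin k u v : pi (free_vec ip Phi (k *: u + v)) =
  k *: pi (free_vec ip Phi u) + pi (free_vec ip Phi v).
Proof. by rewrite (quot_pi_rel (smash_linear ip Phi k u v)) !linearP. Qed.

Lemma cher_x_linear k u v : X (k *: u + v) = k%:RC *: X u + X v.
Proof.
rewrite -[RHS]pi_vec_lin; congr (pi (free_vec ip Phi _)).
by rewrite /complexify map_mxD map_mxZ; congr pair; rewrite /= scaler0 addr0.
Qed.

Lemma cher_y_linear k u v : Y (k *: u + v) = k%:RC *: Y u + Y v.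
Proof.
rewrite -[RHS]pi_vec_lin; congr (pi (free_vec ip Phi _)).
by rewrite /complexify map_mxD map_mxZ; congr pair; rewrite /= scaler0 addr0.
Qed.

Lemma cher_xC u v : X u * X v = X v * X u.
Proof.
have := quot_pi_rel (cherednik_xx ip Pos c (complexify u) (complexify v)).
by rewrite rmorphB !rmorphM rmorph0 => /subr0_eq.
Qed.

Lemma cher_yC u v : Y u * Y v = Y v * Y u.
Proof.
have := quot_pi_rel (cherednik_yy ip Pos c (complexify u) (complexify v)).
by rewrite rmorphB !rmorphM rmorph0 => /subr0_eq.
Qed.

Lemma cher_w1 w : val w = 1%:M -> cw w = 1.
Proof. by move=> w1; rewrite /cher_w /smash_w (quot_pi_rel (smash_grp1 w1)) !rmorph1. Qed.

Lemma cher_w_vec w u :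
  cw w * pi (free_vec ip Phi u) = pi (free_vec ip Phi (act w u)) * cw w.
Proof.
have piM u1 u2 : pi (u1 * u2) = pi u1 * pi u2.
  by apply: etrans (congr1 _ (rmorphM _ u1 u2)) (rmorphM _ _ _).
have := congr1 (quot_pi (cherednik_rel Pos c)) (quot_pi_rel (smash_act w u)).
by move=> e; apply: etrans (esym (piM _ _)) (etrans e (piM _ _)).
Qed.

Lemma cher_w_x w u : cw w * X u = X (u *m invmx (val w)) * cw w.
Proof.
rewrite [LHS]cher_w_vec; congr (pi (free_vec ip Phi _) * _).
by rewrite /act /complexify /= mulmx0 map_mxM.
Qed.

Lemma cher_w_y w u : cw w * Y u = Y (val w *m u) * cw w.
Proof.
rewrite [LHS]cher_w_vec; congr (pi (free_vec ip Phi _) * _).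
by rewrite /act /complexify /= mul0mx map_mxM.
Qed.

Lemma cher_yx v u : comm_ad (Y v) (X u) = ((u *m v) 0 0)%:RC *: (1 : A)
  - \sum_(a in Pos) (c a * ((ip (val a) v)%:RC * ((u *m coroot ip (val a)) 0 0)%:RC))
      *: cw (reflectionW ip a).
Proof.
have := quot_pi_rel (cherednik_yx ip Pos c (complexify v) (complexify u)).
rewrite rmorphB !rmorphM quot_pi_lin_comb -comm_adE => e; apply: etrans e _.
have -> : pairing (complexify u) (complexify v) = ((u *m v) 0 0)%:RC.
  by rewrite /pairing -map_mxM mxE.
apply: (congr1 (fun q : A => _ - q)); apply: eq_bigr => a _.
apply: (congr1 (fun k => k *: cw (reflectionW ip a))).
rewrite /pairing -!map_mxM mxE [X in _ * X]mxE -mulrA; congr (_ * (_%:RC * _)).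
by rewrite flat_mul mxE mulr1n.
Qed.

(** Words grow on the right, which is the side on which the span of the strings
    is stable. *)
Lemma cher_ind (P : A -> Prop) : P 1 -> (forall k p q, P p -> P q -> P (k *: p + q)) ->
  (forall p y, P p -> P (p * pi (free_vec ip Phi y))) ->
  (forall p w, P p -> P (p * cw w)) -> forall p, P p.
Proof.
move=> P1 Plin PV Pw p.
have [v ->] := quot_pi_surj p; have [u ->] := quot_pi_surj v.
elim/free_ind: u => [|k u1 u2 P1' P2'|u [z|w] Pu]; first by rewrite !rmorph1.
- by rewrite !linearP; apply: Plin.
- by rewrite !rmorphM; apply: (PV _ z).
- by rewrite !rmorphM; apply: Pw.
Qed.

End Cherednik.

(** * Sums of squares over an orthonormal basis *)

Section Frame.
Variables (R : realType) (r : nat) (ip : {dot 'cV[R]_r for idfun}).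
Local Notation E := 'cV[R]_r.
Variables (x : 'I_r -> 'rV[R]_r) (y : 'I_r -> E).
Hypothesis hy : forall i j, ip (y i) (y j) = (i == j)%:R.
Hypothesis hx : forall i j, (x i *m y j) 0 0 = (i == j)%:R.

Lemma frame_resolution : \sum_j y j *m x j = 1%:M.
Proof.
pose a : 'M[R]_r := \matrix_(i, j) x i 0 j; pose b : 'M[R]_r := \matrix_(i, j) y j i 0.
have /mulmx1C ba : a *m b = 1%:M.
  apply/matrixP => i j; rewrite !mxE -hx mxE.
  by apply: eq_bigr => k _; rewrite !mxE.
rewrite -ba; apply/matrixP => i j; rewrite summxE mxE.
by apply: eq_bigr => k _; rewrite !mxE big_ord1.
Qed.

Lemma frame_coord j v : (x j *m v) 0 0 = ip (y j) v.
Proof.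
rewrite -[v in RHS]mul1mx -frame_resolution mulmx_suml linear_sumr (bigD1 j) //= big1 => [|k kj].
  rewrite addr0 -mulmxA [x j *m v]mx11_scalar mul_mx_scalar linearZr_LR /=.
  by rewrite hy eqxx mulr1 mxE.
rewrite -mulmxA [x k *m v]mx11_scalar mul_mx_scalar linearZr_LR /=.
by rewrite hy eq_sym (negPf kj) mulr0.
Qed.

Lemma frame_expand v : v = \sum_j ip (y j) v *: y j.
Proof.
rewrite -{1}[v]mul1mx -frame_resolution mulmx_suml; apply: eq_bigr => j _.
by rewrite -mulmxA [x j *m v]mx11_scalar mul_mx_scalar frame_coord.
Qed.

Lemma frame_dual j : x j = flat ip (y j).
Proof.
apply: mulmx_cV_inj => v; rewrite flat_mul [LHS]mx11_scalar; congr (_%:M).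
exact: frame_coord.
Qed.

Lemma frame_parseval u v : \sum_i ip (y i) u * ip (y i) v = ip u v.
Proof.
rewrite {2}(frame_expand u) linear_sumlz; apply: eq_bigr => i _.
by rewrite linearZl_LR.
Qed.

Variables (A : algType R[i]) (rel : A -> A -> Prop).
Local Notation Q := (quot_algebra rel).
Local Notation "k %:RC" := (real_complex R k) (at level 2).

(** The x and the y behave in the same way once the x are indexed by vectors
    through the inner product: both are linear families [Z] of elements indexed
    by Euclidean vectors, and their sums of squares are proportional to the
    nilpotent elements of the triple. *)
Section OneFamily.
Variable Z : E -> Q.
Hypothesis Zlin : forall k u v, Z (k *: u + v) = k%:RC *: Z u + Z v.

Lemma family0 : Z 0 = 0.
Proof. by have := Zlin (-1) 0 0; rewrite rmorphN1 !scaleN1r !addNr. Qed.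

Lemma family_sum (I : finType) (k : I -> R) (v : I -> E) :
  Z (\sum_i k i *: v i) = \sum_i (k i)%:RC *: Z (v i).
Proof.
elim/big_ind2: _ => [|_ p _ q <- <-|i _]; first exact: family0.
  by rewrite -[p in LHS]scale1r Zlin rmorph1 scale1r.
by rewrite -[_ *: _]addr0 Zlin family0 addr0.
Qed.

Lemma family_expand v : Z v = \sum_j (ip (y j) v)%:RC *: Z (y j).
Proof. by rewrite {1}(frame_expand v) family_sum. Qed.

Definition sq_norm : Q := \sum_i Z (y i) * Z (y i).

(** An orthogonal change of basis does not affect the sum of squares: the
    coordinates of the new basis form an orthogonal matrix. *)
Lemma sq_norm_orth (g : 'M[R]_r) : (forall u v, ip (g *m u) (g *m v) = ip u v) ->
  g \in unitmx -> \sum_i Z (g *m y i) * Z (g *m y i) = sq_norm.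
Proof.
move=> og ug.
have -> : \sum_i Z (g *m y i) * Z (g *m y i) = \sum_i \sum_j \sum_k
    (ip (y j) (g *m y i) * ip (y k) (g *m y i))%:RC *: (Z (y j) * Z (y k)).
  apply: eq_bigr => i _; rewrite (family_expand (g *m y i)) mulr_suml.
  apply: eq_bigr => j _; rewrite mulr_sumr; apply: eq_bigr => k _.
  by rewrite -quot_scalerAl -quot_scalerAr scalerA rmorphM.
have gram j k : \sum_i ip (y j) (g *m y i) * ip (y k) (g *m y i) = (j == k)%:R.
  have adj i l : ip (y l) (g *m y i) = ip (y i) (invmx g *m y l).
    by rewrite -[y l in LHS](mulKVmx ug) og ipC.
  under eq_bigr => i _ do rewrite !adj.
  by rewrite frame_parseval -og !(mulKVmx ug) hy.
rewrite exchange_big; apply: eq_bigr => j _ /=.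
rewrite exchange_big (bigD1 j) //= [X in _ + X]big1 ?addr0 => [|k kj].
  by rewrite -scaler_suml -rmorph_sum /= gram eqxx rmorph1 scale1r.
by rewrite -scaler_suml -rmorph_sum /= gram eq_sym (negPf kj) rmorph0 scale0r.
Qed.

Variables (W : Type) (mat : W -> 'M[R]_r) (sW : W -> Q).
Hypothesis mat_orth : forall w u v, ip (mat w *m u) (mat w *m v) = ip u v.
Hypothesis mat_unit : forall w, mat w \in unitmx.
Hypothesis sWZ : forall w u, sW w * Z u = Z (mat w *m u) * sW w.

Lemma sq_norm_comm w : comm_ad sq_norm (sW w) = 0.
Proof.
rewrite comm_ad_antisym comm_adE /sq_norm mulr_sumr.
under eq_bigr => i _ do rewrite mulrA sWZ -mulrA sWZ mulrA.
by rewrite -mulr_suml sq_norm_orth // subrr oppr0.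
Qed.

Variables (Phi : {fset E}) (S : {pred Phi}) (sr : Phi -> Q) (k : Phi -> R[i]).
Hypothesis srZ : forall a, sr a * Z (val a) = - (Z (val a) * sr a).

(** The value of the commutator of y and x, as a form with values in the group
    algebra.  Absorbing the factor 2 / (a, a) of the coroot into [k] makes its
    symmetry visible. *)
Definition deformed_form u v : Q := (ip u v)%:RC *: (1 : Q)
  - \sum_(a in S) (k a * (ip (val a) u * ip (val a) v)%:RC) *: sr a.

Lemma deformed_formC u v : deformed_form u v = deformed_form v u.
Proof.
rewrite /deformed_form ipC; congr (_ - _); apply: eq_bigr => a _.
by rewrite [ip (val a) u * _]mulrC.
Qed.

Lemma family_flat a : \sum_i (ip a (y i))%:RC *: Z (y i) = Z a.
Proof. by rewrite (family_expand a); apply: eq_bigr => i _; rewrite ipC. Qed.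

(** The sum over the basis of (a, y_i) Z(y_i) is Z(a), so the term of the root a
    appears as Z(a) s_a + s_a Z(a), which vanishes. *)
Lemma sq_norm_ad (T : E -> Q) (eps : R[i]) :
  (forall u v, comm_ad (Z u) (T v) = eps *: deformed_form u v) ->
  forall v, comm_ad sq_norm (T v) = (eps *+ 2) *: Z v.
Proof.
move=> ZT v.
have -> : comm_ad sq_norm (T v) =
    eps *: \sum_i (Z (y i) * deformed_form (y i) v + deformed_form (y i) v * Z (y i)).
  rewrite comm_ad_antisym /sq_norm comm_ad_sum -sumrN scaler_sumr.
  apply: eq_bigr => i _; rewrite comm_adM (comm_ad_antisym (T v)) ZT.
  rewrite mulNr mulrN -opprD opprK addrC -quot_scalerAr -quot_scalerAl -scalerDr //.
have scal (a : Phi) i : k a * (ip (val a) (y i) * ip (val a) v)%:RC =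
    k a * (ip (val a) v)%:RC * (ip (val a) (y i))%:RC.
  by rewrite [ip (val a) _ * _]mulrC rmorphM mulrA.
have left_sum : \sum_i Z (y i) * deformed_form (y i) v = Z v
    - \sum_(a in S) (k a * (ip (val a) v)%:RC) *: (Z (val a) * sr a).
  under eq_bigr => i _ do rewrite mulrBr -quot_scalerAr mulr1 mulr_sumr.
  rewrite sumrB -family_expand exchange_big; congr (_ - _); apply: eq_bigr => a _ /=.
  rewrite -(family_flat (val a)) mulr_suml scaler_sumr; apply: eq_bigr => i _.
  by rewrite -quot_scalerAr -quot_scalerAl scalerA scal.
have right_sum : \sum_i deformed_form (y i) v * Z (y i) = Z v
    - \sum_(a in S) (k a * (ip (val a) v)%:RC) *: (sr a * Z (val a)).
  under eq_bigr => i _ do rewrite mulrBl -quot_scalerAl mul1r mulr_suml.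
  rewrite sumrB -family_expand exchange_big; congr (_ - _); apply: eq_bigr => a _ /=.
  rewrite -(family_flat (val a)) mulr_sumr scaler_sumr; apply: eq_bigr => i _.
  by rewrite -quot_scalerAr -quot_scalerAl scalerA scal.
rewrite big_split /= left_sum right_sum.
have -> : \sum_(a in S) (k a * (ip (val a) v)%:RC) *: (sr a * Z (val a)) =
    - \sum_(a in S) (k a * (ip (val a) v)%:RC) *: (Z (val a) * sr a).
  by rewrite -sumrN; apply: eq_bigr => a _; rewrite srZ scalerN.
by rewrite opprK addrACA addNr addr0 -mulr2n -[_ *+ 2 in LHS]scaler_nat scalerA mulr_natr.
Qed.

End OneFamily.
End Frame.

(** * The triple in the Cherednik algebra *)

Section CherednikSl2.
Variables (R : realType) (r : nat) (ip : {dot 'cV[R]_r for idfun}).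
Variables (Phi : {fset 'cV[R]_r}) (Pos : {set Phi}) (c : Phi -> R[i]).
Hypotheses (hPhi : is_root_system ip Phi).
Local Notation E := 'cV[R]_r.
Variables (y : 'I_r -> E) (x : 'I_r -> 'rV[R]_r).
Hypothesis hy : forall i j, ip (y i) (y j) = (i == j)%:R.
Hypothesis hx : forall i j, (x i *m y j) 0 0 = (i == j)%:R.
Local Notation C := R[i].
Local Notation W := (weyl_group ip Phi).
Local Notation A := (cherednik ip Pos c).
Local Notation cw := (@cher_w R r ip Phi Pos c).
Local Notation X := (@cher_x R r ip Phi Pos c).
Local Notation Y := (@cher_y R r ip Phi Pos c).
Local Notation "k %:RC" := (real_complex R k) (at level 2).

Definition cher_flat (u : E) : A := X (flat ip u).
Local Notation Xf := cher_flat.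

Lemma cher_flat_linear k u v : Xf (k *: u + v) = k%:RC *: Xf u + Xf v.
Proof.
rewrite -[RHS]cher_x_linear; congr (X _).
by apply/rowP => j; rewrite !mxE linearPl.
Qed.

Lemma cher_w_flat w u : cw w * Xf u = Xf (val w *m u) * cw w.
Proof.
rewrite [LHS]cher_w_x; congr (X _ * _).
by rewrite -(flat_orth u (weyl_orth w)) mulmxK ?weyl_unit.
Qed.

Lemma refl_skew (Z : E -> A) (a : Phi) :
  (forall k u v, Z (k *: u + v) = k%:RC *: Z u + Z v) ->
  (forall w u, cw w * Z u = Z (val w *m u) * cw w) ->
  cw (reflectionW ip a) * Z (val a) = - (Z (val a) * cw (reflectionW ip a)).
Proof.
move=> Zlin Zw; rewrite Zw [val _ *m _](reflection_root ip (root_neq0 hPhi a)).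
have -> : Z (- val a) = - Z (val a); last exact: mulNr.
by have := Zlin (-1) (val a) 0; rewrite (family0 Zlin) !addr0 rmorphN1 !scaleN1r.
Qed.

Local Notation G := (deformed_form ip (mem Pos) (fun a => cw (reflectionW ip a))
   (fun a => c a * (2 / ip (val a) (val a))%:RC)).

Lemma cher_y_flat v u : comm_ad (Y v) (Xf u) = G v u.
Proof.
apply: etrans (@cher_yx R r ip Phi Pos c v (flat ip u)) _.
rewrite flat_mul mxE mulr1n ipC.
apply: (congr1 (fun q : A => _ - q)); apply: eq_bigr => a _.
apply: (congr1 (fun k => k *: cw (reflectionW ip a))).
rewrite flat_mul mxE mulr1n /coroot linearZr_LR /= (ipC ip u) -!mulrA -!rmorphM.
by congr (_ * _%:RC); ring.
Qed.

Lemma cher_flat_y u v : comm_ad (Xf u) (Y v) = (-1) *: G u v.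
Proof. by rewrite comm_ad_antisym cher_y_flat deformed_formC scaleN1r. Qed.

Local Notation e := (sl2_Ep ip Pos c x).
Local Notation f := (sl2_Em ip Pos c y).
Local Notation h := (sl2_H ip Pos c x y).

Lemma sl2_EmE : f = 2^-1 *: sq_norm y Y.
Proof. by []. Qed.

Lemma sl2_EpE : e = - (2^-1 *: sq_norm y Xf).
Proof.
congr (- (_ *: _)); apply: eq_bigr => i _.
by rewrite (frame_dual hy hx).
Qed.

Lemma half2 : 2^-1 * 2 = 1 :> C.
Proof. by rewrite mulVf ?pnatr_eq0. Qed.

Lemma sq_norm_ad0 (Z : E -> A) : (forall u v, Z u * Z v = Z v * Z u) ->
  forall v, comm_ad (sq_norm y Z) (Z v) = 0.
Proof.
move=> ZC v; rewrite comm_adE /sq_norm mulr_sumr mulr_suml -sumrB big1 // => i _.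
by rewrite -mulrA (ZC _ v) mulrA (ZC _ v) mulrA subrr.
Qed.

Lemma ad_f_y v : comm_ad f (Y v) = 0.
Proof. by rewrite sl2_EmE comm_adZl sq_norm_ad0 ?scaler0 //; exact: cher_yC. Qed.

Lemma ad_e_x v : comm_ad e (Xf v) = 0.
Proof.
rewrite sl2_EpE comm_adNl comm_adZl sq_norm_ad0 ?scaler0 ?oppr0 // => *; exact: cher_xC.
Qed.

Lemma ad_f_x v : comm_ad f (Xf v) = Y v.
Proof.
rewrite sl2_EmE comm_adZl.
rewrite (sq_norm_ad hy hx (cher_y_linear ip Pos c) _ (eps := 1) (T := Xf)
   (S := mem Pos) (sr := fun a => cw (reflectionW ip a))
   (k := fun a => c a * (2 / ip (val a) (val a))%:RC)).
- by rewrite scalerA half2 scale1r.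
- by move=> a; apply: refl_skew; [exact: cher_y_linear | exact: cher_w_y].
- by move=> u w; rewrite cher_y_flat scale1r.
Qed.

Lemma ad_e_y v : comm_ad e (Y v) = Xf v.
Proof.
rewrite sl2_EpE comm_adNl comm_adZl.
rewrite (sq_norm_ad hy hx cher_flat_linear _ (eps := -1) (T := Y)
   (S := mem Pos) (sr := fun a => cw (reflectionW ip a))
   (k := fun a => c a * (2 / ip (val a) (val a))%:RC)).
- by rewrite scalerA mulNrn mulrN half2 scaleN1r opprK.
- by move=> a; apply: refl_skew; [exact: cher_flat_linear | exact: cher_w_flat].
- exact: cher_flat_y.
Qed.

Lemma sl2_hE : h = comm_ad e f.
Proof.
rewrite sl2_EmE comm_adZ comm_ad_sum; congr (_ *: _); apply: eq_bigr => i _.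
by rewrite comm_adM ad_e_y (frame_dual hy hx).
Qed.

Lemma ad_h_x v : comm_ad h (Xf v) = Xf v.
Proof. by rewrite sl2_hE comm_ad_jacobi ad_f_x ad_e_y ad_e_x comm_ad0 subr0. Qed.

Lemma ad_h_y v : comm_ad h (Y v) = - Y v.
Proof. by rewrite sl2_hE comm_ad_jacobi ad_f_y ad_e_y ad_f_x comm_ad0 sub0r. Qed.

Lemma ad_h_f : comm_ad h f = - (f *+ 2).
Proof.
rewrite [in LHS]sl2_EmE comm_adZ comm_ad_sum sl2_EmE scalerMnr -scalerN; congr (_ *: _).
rewrite /sq_norm -sumrMnl -sumrN; apply: eq_bigr => i _.
by rewrite comm_adM ad_h_y mulNr mulrN -opprD.
Qed.

Lemma ad_h_e : comm_ad h e = e *+ 2.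
Proof.
rewrite [in LHS]sl2_EpE comm_adN comm_adZ comm_ad_sum sl2_EpE mulNrn scalerMnr.
congr (- (_ *: _)).
rewrite /sq_norm -sumrMnl; apply: eq_bigr => i _.
by rewrite comm_adM ad_h_x.
Qed.

Lemma ad_f_w w : comm_ad f (cw w) = 0.
Proof.
rewrite sl2_EmE comm_adZl.
rewrite (sq_norm_comm hy hx (cher_y_linear ip Pos c) (mat := val) (sW := cw)).
- exact: scaler0.
- exact: weyl_orth.
- exact: weyl_unit.
- exact: cher_w_y.
Qed.

Lemma ad_e_w w : comm_ad e (cw w) = 0.
Proof.
rewrite sl2_EpE comm_adNl comm_adZl.
rewrite (sq_norm_comm hy hx cher_flat_linear (mat := val) (sW := cw)) ?scaler0 ?oppr0 //.
- exact: weyl_orth.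
- exact: weyl_unit.
- exact: cher_w_flat.
Qed.

End CherednikSl2.

(** * The centraliser of the triple *)

Section GroupAlgebra.
Variables (R : realType) (r : nat) (ip : {dot 'cV[R]_r for idfun}).
Variables (Phi : {fset 'cV[R]_r}) (Pos : {set Phi}) (c : Phi -> R[i]).
Hypotheses (hPhi : is_root_system ip Phi).
Local Notation E := 'cV[R]_r.
Variables (y : 'I_r -> E) (x : 'I_r -> 'rV[R]_r).
Hypothesis hy : forall i j, ip (y i) (y j) = (i == j)%:R.
Hypothesis hx : forall i j, (x i *m y j) 0 0 = (i == j)%:R.
Local Notation C := R[i].
Local Notation W := (weyl_group ip Phi).
Local Notation A := (cherednik ip Pos c).
Local Notation cw := (@cher_w R r ip Phi Pos c).
Local Notation X := (@cher_x R r ip Phi Pos c).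
Local Notation Y := (@cher_y R r ip Phi Pos c).
Local Notation Xf := (@cher_flat R r ip Phi Pos c).
Local Notation "k %:RC" := (real_complex R k) (at level 2).
Local Notation GA := (@group_algebra R r ip Phi Pos c).
Local Notation pi u :=
  (quot_pi (cherednik_rel Pos c) (quot_pi (@smash_rel R r ip Phi) u)).
Local Notation vec u := (pi (free_vec ip Phi u)).
Local Notation U := (generated_subalgebra (@U_gens R r ip Phi Pos c x y)).
Local Notation e := (sl2_Ep ip Pos c x).
Local Notation f := (sl2_Em ip Pos c y).
Local Notation h := (sl2_H ip Pos c x y).
Local Notation s := (span3 h e f).

Lemma group_algebra_w w : GA (cw w).
Proof. by exists [:: (1, w)]; rewrite big_seq1 scale1r. Qed.

Lemma group_algebra0 : GA 0.
Proof. by exists [::]; rewrite big_nil. Qed.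

Lemma group_algebra_lin k p q : GA p -> GA q -> GA (k *: p + q).
Proof.
move=> [sp ->] [sq ->]; exists ([seq (k * t.1, t.2) | t <- sp] ++ sq).
rewrite big_cat big_map scaler_sumr /=; congr (_ + _).
by apply: eq_bigr => t _; rewrite scalerA.
Qed.

Lemma group_algebraZ k p : GA p -> GA (k *: p).
Proof.
by move=> Gp; rewrite -[k *: p]addr0; apply: group_algebra_lin Gp group_algebra0.
Qed.

Lemma group_algebra_sum (I : Type) (l : seq I) (S : pred I) (k : I -> C) (p : I -> A) :
  (forall i, GA (p i)) -> GA (\sum_(i <- l | S i) k i *: p i).
Proof.
move=> Gp; elim: l => [|i l IHl]; first by rewrite big_nil; exact: group_algebra0.
by rewrite big_cons; case: ifP => // _; exact: group_algebra_lin.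
Qed.

Lemma group_algebra1 : GA 1.
Proof.
have W1 : `[< in_reflection_group ip Phi 1%:M >] by apply/asboolP/in_refl_group1.
by rewrite -(cher_w1 Pos c (w := exist _ 1%:M W1) erefl); exact: group_algebra_w.
Qed.

Lemma group_algebra_comm_yx u v : GA (comm_ad (Y v) (Xf u)).
Proof.
rewrite cher_y_flat /deformed_form -[- _]scaleN1r addrC; apply: group_algebra_lin.
  by apply: group_algebra_sum => a; exact: group_algebra_w.
exact/group_algebraZ/group_algebra1.
Qed.

(** A group element w that crosses x to the left turns it into w^-1 x, which is
    then expanded in the basis. *)
Lemma cher_flat_group_algebra i p : GA p ->
  exists2 t : 'I_r -> A, (forall j, GA (t j)) & Xf (y i) * p = \sum_j t j * Xf (y j).
Proof.
move=> [l ->].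
exists (fun j => \sum_(t <- l) (t.1 * (ip (y j) (invmx (val t.2) *m y i))%:RC) *: cw t.2).
  by move=> j; apply: group_algebra_sum => t; exact: group_algebra_w.
transitivity (\sum_(t <- l) \sum_j
    (t.1 * (ip (y j) (invmx (val t.2) *m y i))%:RC) *: cw t.2 * Xf (y j)); last first.
  by rewrite exchange_big; apply: eq_bigr => j _; rewrite -mulr_suml.
rewrite mulr_sumr; apply: eq_bigr => -[k w] _.
rewrite [(k, w).1]/= [(k, w).2]/=.
have -> : Xf (y i) = Xf (val w *m (invmx (val w) *m y i)).
  by rewrite mulKVmx ?weyl_unit.
rewrite -quot_scalerAr -cher_w_flat.
rewrite (family_expand hy hx (cher_flat_linear ip Pos c) (_ *m y i)).
rewrite mulr_sumr scaler_sumr; apply: eq_bigr => j _.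
by rewrite -quot_scalerAr -quot_scalerAl scalerA.
Qed.

Lemma vec_expand u : exists a b : 'I_r -> C,
  vec u = \sum_i a i *: Y (y i) + \sum_i b i *: Xf (y i).
Proof.
case: u => v w.
have cE : \sum_j complexify (y j) *m complexify (x j) = 1%:M.
  rewrite -(map_mx1 (real_complex R)) -(frame_resolution hx) map_mx_sum.
  by apply: eq_bigr => j _; rewrite /complexify map_mxM.
exists (fun i => (complexify (x i) *m v) 0 0), (fun i => (w *m complexify (y i)) 0 0).
have lin_sum (V : lmodType C) (L : V -> A) (I : finType) (k : I -> C) (z : I -> V) :
    (forall a u1 u2, L (a *: u1 + u2) = a *: L u1 + L u2) ->
    L (\sum_i k i *: z i) = \sum_i k i *: L (z i).
  move=> Llin; have L0 : L 0 = 0 by have := Llin (-1) 0 0; rewrite !scaleN1r !addNr.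
  elim/big_ind2: _ => [|_ p _ q <- <-|i _]; first exact: L0.
    by rewrite -[p in LHS]scale1r Llin scale1r.
  by rewrite -[_ *: _]addr0 Llin L0 addr0.
have -> : vec (v, w) = vec (v, 0) + vec (0, w).
  rewrite -[vec (v, 0)]scale1r -pi_vec_lin; congr (pi (free_vec ip Phi _)).
  by congr pair; rewrite /= ?scaler0 ?scale1r ?addr0 ?add0r.
congr (_ + _).
  rewrite -{1}[v]mul1mx -cE mulmx_suml.
  transitivity (vec (\sum_i (complexify (x i) *m v) 0 0 *: complexify (y i), 0)).
    congr (vec (_, _)); apply: eq_bigr => i _.
    by rewrite -mulmxA {1}[complexify (x i) *m v]mx11_scalar mul_mx_scalar.
  apply: (lin_sum _ (fun z => vec (z, 0))) => a u1 u2.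
  by rewrite -pi_vec_lin; congr (vec _); congr pair; rewrite /= scaler0 addr0.
rewrite -{1}[w]mulmx1 -cE mulmx_sumr.
transitivity (vec (0, \sum_i (w *m complexify (y i)) 0 0 *: complexify (x i))).
  congr (vec (_, _)); apply: eq_bigr => i _.
  by rewrite mulmxA {1}[w *m complexify (y i)]mx11_scalar mul_scalar_mx.
apply: etrans (lin_sum _ (fun z => vec (0, z)) _ _ _ _) _ => [a u1 u2|].
  by rewrite -pi_vec_lin; congr (vec _); congr pair; rewrite /= scaler0 addr0.
by apply: eq_bigr => i _; rewrite (frame_dual hy hx).
Qed.

Lemma U_group_algebra p : GA p -> U p.
Proof. by move=> Gp; apply: gen_subalg_mem; left. Qed.

Local Notation ang i j := (Xf (y i) * Y (y j) - Xf (y j) * Y (y i)).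

Lemma angular_flat i j : angular ip Pos c x y i j = ang i j.
Proof. by rewrite /angular !(frame_dual hy hx). Qed.

Lemma U_angular i j : U (ang i j).
Proof.
have Ult (k l : 'I_r) : (k < l)%N -> U (ang k l).
  by move=> kl; apply: gen_subalg_mem; right; exists k, l; rewrite angular_flat.
case: (ltngtP i j) => [/Ult //|ji|/val_inj ->].
  by rewrite -opprB; apply/gen_subalgN/Ult.
by rewrite subrr; exact: gen_subalg0.
Qed.

Lemma comm_ad_U z : (forall w, comm_ad z (cw w) = 0) ->
  (forall i j, comm_ad z (ang i j) = 0) -> forall p, U p -> comm_ad z p = 0.
Proof.
move=> zw zang p.
elim=> {p} [p [[l ->]|[i [j [_ ->]]]]||k p q _ IHp _ IHq|p q _ IHp _ IHq].
- rewrite comm_ad_sum big1 // => t _; by rewrite comm_adZ zw scaler0.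
- by rewrite angular_flat.
- exact: comm_ad1.
- by rewrite comm_adD comm_adZ IHp IHq scaler0 addr0.
- by rewrite comm_adM IHp IHq mul0r mulr0 addr0.
Qed.

Lemma ad_e_U p : U p -> comm_ad e p = 0.
Proof.
apply: comm_ad_U => [|i j]; first exact: (ad_e_w Pos c hy hx).
rewrite comm_adB !comm_adM !(ad_e_x Pos c hy hx) !(ad_e_y Pos c hPhi hy hx).
rewrite !mul0r !add0r.
by rewrite (cher_xC _ _ _ (flat ip (y j))) subrr.
Qed.

Lemma ad_f_U p : U p -> comm_ad f p = 0.
Proof.
apply: comm_ad_U => [|i j]; first exact: (ad_f_w Pos c hy hx).
rewrite comm_adB !comm_adM !(ad_f_y ip Pos c y) !(ad_f_x Pos c hPhi hy hx).
rewrite !mulr0 !addr0.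
by rewrite (cher_yC _ _ _ (y j)) subrr.
Qed.

(** Since h = [e, f], commuting with e and f is enough. *)
Lemma centraliser_sl2 p : centraliser s p <-> comm_ad e p = 0 /\ comm_ad f p = 0.
Proof.
split=> [sp|[ep fp] _ [k [l [m ->]]]].
  split; apply/comm_ad_commute/sp.
    by exists 0, 1, 0; rewrite !scale0r scale1r add0r addr0.
  by exists 0, 0, 1; rewrite !scale0r scale1r !add0r.
have hp : comm_ad h p = 0.
  by rewrite (sl2_hE Pos c hPhi hy hx) comm_ad_jacobi ep fp !comm_ad0 subr0.
suff sp : comm_ad (k *: h + l *: e + m *: f : A) p = 0 by exact/comm_ad_commute/sp.
have ad0Z a (z : A) : comm_ad z p = 0 -> comm_ad (a *: z) p = 0.
  by move=> z0; apply: etrans (comm_adZl _ _ _) (etrans (congr1 _ z0) (scaler0 _ _)).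
by rewrite 2!comm_adDl (ad0Z k h hp) (ad0Z l e ep) (ad0Z m f fp) !addr0.
Qed.

Lemma sl2_invariants_U p : comm_ad e p = 0 -> comm_ad f p = 0 -> U p.
Proof.
apply: (sl2_invariants_generated (X := fun i => Xf (y i)) (Y := fun i => Y (y i)) (S := GA)).
- by move=> i j; exact: cher_xC.
- by move=> i; exact: (ad_e_x Pos c hy hx).
- by move=> i; exact: (ad_e_y Pos c hPhi hy hx).
- by move=> i; exact: (ad_f_x Pos c hPhi hy hx).
- by move=> i; exact: (ad_f_y ip Pos c y).
- by rewrite -(sl2_hE Pos c hPhi hy hx) (ad_h_f Pos c hPhi hy hx).
- exact: gen_subalg_1.
- exact: gen_subalgN.
- exact: gen_subalgD.
- exact: gen_subalg_mul.
- move=> n; exists ((n.+1%:R^-1 : C) *: (1 : A)); first exact/gen_subalgZ/gen_subalg_1.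
  rewrite -quot_scalerAl mul1r -(scaler_nat n.+1 (1 : A)) scalerA.
  by rewrite mulVf ?scale1r // pnatr_eq0.
- exact: ad_e_U.
- exact: ad_f_U.
- exact: U_group_algebra.
- exact: U_angular.
- exact: cher_flat_group_algebra.
- by move=> i j; rewrite -comm_adE; exact: group_algebra_comm_yx.
move=> P P1 PD PU PX PY PS; elim/cher_ind => [//|k q t Pq Pt|q z Pq|q w Pq].
- apply: PD => //; rewrite -[q]mul1r quot_scalerAl; apply: PU => //.
  exact/gen_subalgZ/gen_subalg_1.
- have P0 : P 0 by rewrite -(mul0r 1); apply: PU P1; exact: gen_subalg0.
  have PZ k t : P t -> P (k *: t).
    move=> Pt; rewrite -[t]mul1r quot_scalerAl; apply: PU Pt.
    exact/gen_subalgZ/gen_subalg_1.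
  have [a [b ->]] := vec_expand z; rewrite mulrDr !mulr_sumr; apply: (PD).
    by apply: (big_ind P P0 PD) => i _; rewrite -quot_scalerAr; apply/PZ/PY.
  by apply: (big_ind P P0 PD) => i _; rewrite -quot_scalerAr; apply/PZ/PX.
- by apply: PS => //; exact: group_algebra_w.
Qed.

Lemma U_centraliser p : U p <-> centraliser s p.
Proof.
split=> [Up|/centraliser_sl2[ep fp]]; last exact: sl2_invariants_U.
by apply/centraliser_sl2; split; [exact: ad_e_U | exact: ad_f_U].
Qed.

End GroupAlgebra.

(** * The span of a triple is isomorphic to sl(2) *)
Section Sl2Triple.
Variables (K : numFieldType) (A : algType K) (rel : A -> A -> Prop).
Local Notation Q := (quot_algebra rel).
Variables e f : Q.
Local Notation h := (comm_ad e f).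
Hypotheses (he : comm_ad h e = e *+ 2) (hf : comm_ad h f = - (f *+ 2)).
Hypothesis h0 : h != 0.

(** On trace-zero matrices this is the linear map sending the standard basis of
    sl(2) to [h], [e] and [f]. *)
Definition sl2_map (M : 'M[K]_2) : Q := M 0 0 *: h + M 0 1 *: e + M 1 0 *: f.

Fact sl2_map_is_linear : linear sl2_map.
Proof.
move=> k M N; rewrite /sl2_map !mxE !scalerDl -!scalerA !scalerDr.
by rewrite [LHS](AC ((2*2)*2) ((1*3*5)*(2*4*6))).
Qed.
HB.instance Definition _ :=
  GRing.isLinear.Build K 'M[K]_2 Q *:%R sl2_map sl2_map_is_linear.

Lemma ad_h_comb a b d :
  comm_ad h (a *: h + b *: e + d *: f) = (b *+ 2) *: e - (d *+ 2) *: f.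
Proof.
rewrite !comm_adD !comm_adZ he hf [comm_ad h h]comm_adE subrr scaler0 add0r.
by rewrite scalerN -!scalerMnr !scalerMnl.
Qed.

Lemma ad_e_comb a b d :
  comm_ad e (a *: h + b *: e + d *: f) = d *: h - (a *+ 2) *: e.
Proof.
rewrite !comm_adD !comm_adZ [comm_ad e h]comm_ad_antisym he.
rewrite [comm_ad e e]comm_adE subrr scaler0 addr0.
by rewrite addrC scalerN -!scalerMnr !scalerMnl.
Qed.

Lemma ad_f_comb a b d :
  comm_ad f (a *: h + b *: e + d *: f) = (a *+ 2) *: f - b *: h.
Proof.
rewrite !comm_adD !comm_adZ [comm_ad f h]comm_ad_antisym hf.
rewrite [comm_ad f f]comm_adE subrr scaler0 addr0.
by rewrite opprK [comm_ad f e]comm_ad_antisym scalerN -!scalerMnr !scalerMnl.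
Qed.

Lemma trace0_sl2 (M : 'M[K]_2) : \tr M = 0 -> M 1 1 = - M 0 0.
Proof.
rewrite /mxtrace !big_ord_recl big_ord0 addr0 => /eqP; rewrite addrC addr_eq0 => /eqP <-.
by congr (M _ _); apply: val_inj.
Qed.

(** sl(2) is simple: applying ad(e) and ad(h) to a relation isolates one
    coefficient after the other. *)
Lemma sl2_map_inj M : \tr M = 0 -> sl2_map M = 0 -> M = 0.
Proof.
move=> /trace0_sl2 M11; rewrite /sl2_map => M0.
have e0 : e != 0 by apply: contraNneq h0 => ->; rewrite comm_adE mul0r mulr0 subrr.
have two : 2 != 0 :> K by rewrite pnatr_eq0.
have be : M 1 0 *: h - (M 0 0 *+ 2) *: e = 0.
  by rewrite -(ad_e_comb _ (M 0 1)) M0 comm_ad0.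
have := congr1 (comm_ad h) be.
rewrite comm_adB !comm_adZ comm_ad0 he [comm_ad h h]comm_adE subrr scaler0 sub0r => /eqP.
rewrite oppr_eq0 -scaler_nat !scaler_eq0 (negPf e0) (negPf two) !orbF.
rewrite -mulr_natr mulf_eq0 (negPf two) orbF => /eqP M00.
move: be; rewrite M00 mul0rn scale0r subr0 => /eqP.
rewrite scaler_eq0 (negPf h0) orbF => /eqP M10.
move: M0; rewrite M00 M10 !scale0r addr0 add0r => /eqP.
rewrite scaler_eq0 (negPf e0) orbF => /eqP M01.
apply/matrixP => i j; rewrite mxE.
have ord2 (k : 'I_2) : k = 0 \/ k = 1.
  by case: k => [[|[|//]] k]; [left | right]; apply: val_inj.
by case: (ord2 i) (ord2 j) => -> [] ->; rewrite ?M11 ?M00 ?oppr0.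
Qed.

Lemma sl2_map_bracket M N : \tr M = 0 -> \tr N = 0 ->
  sl2_map (M *m N - N *m M) = comm_ad (sl2_map M) (sl2_map N).
Proof.
move=> /trace0_sl2 M11 /trace0_sl2 N11.
have mulE (P S : 'M[K]_2) i j : (P *m S) i j = P i 0 * S 0 j + P i 1 * S 1 j.
  rewrite mxE !big_ord_recl big_ord0 addr0; congr (_ + P _ _ * S _ _); exact: val_inj.
rewrite [sl2_map M in RHS]/sl2_map !comm_adDl !comm_adZl ad_h_comb ad_e_comb ad_f_comb.
rewrite !scalerBr !scalerA [RHS](AC ((2*2)*2) ((3*6)*(1*4)*(5*2))).
rewrite /= -!scaleNr -!scalerDl /sl2_map.
by congr (_ *: _ + _ *: _ + _ *: _); rewrite mxE [X in _ + X]mxE !mulE ?M11 ?N11; ring.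
Qed.

Lemma span3_sl2_map p : span3 h e f p <-> exists2 M, \tr M = 0 & p = sl2_map M.
Proof.
split=> [[a [b [d ->]]]|[M _ ->]]; last by exists (M 0 0), (M 0 1), (M 1 0).
exists (\matrix_(i < 2, j < 2) if i == j then (if i == 0 then a else - a)
                              else (if i == 0 then b else d)).
  by rewrite /mxtrace !big_ord_recl big_ord0 !mxE /= addr0 subrr.
by rewrite /sl2_map !mxE.
Qed.

Lemma isomorphic_sl2_triple : isomorphic_sl2 (span3 h e f).
Proof.
exists sl2_map; split; [exact: sl2_map_inj | exact: span3_sl2_map |].
by move=> M N trM trN; apply: etrans (sl2_map_bracket trM trN) _; exact: comm_adE.
Qed.
End Sl2Triple.

Theorem theorem1 (R : realType) (r : nat) (ip : {dot 'cV[R]_r for idfun})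
    (Phi : {fset 'cV[R]_r}) (Pos : {set Phi}) (c : Phi -> R[i])
    (hPhi : is_root_system ip Phi) (hPos : is_positive_system ip Pos)
    (hc : W_invariant ip c)
    (y : 'I_r -> 'cV[R]_r) (x : 'I_r -> 'rV[R]_r)
    (hy : forall i j, ip (y i) (y j) = (i == j)%:R)
    (hx : forall i j, (x i *m y j) 0 0 = (i == j)%:R) :
  let U := generated_subalgebra (@U_gens R r ip Phi Pos c x y) in
  let s := span3 (sl2_H ip Pos c x y) (sl2_Ep ip Pos c x)
                 (sl2_Em ip Pos c y) in
  ((0 < r)%N -> isomorphic_sl2 s)
  /\ forall p : cherednik ip Pos c, U p <-> centraliser s p.
Proof.
move=> U s; split=> [r_gt0|p]; last exact: U_centraliser.
have hE := sl2_hE Pos c hPhi hy hx.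
rewrite /s hE; apply: isomorphic_sl2_triple.
- by rewrite -hE; exact: ad_h_e.
- by rewrite -hE; exact: ad_h_f.
rewrite -hE; apply/eqP => H0.
have X0 := ad_h_x Pos c hPhi hy hx (y (Ordinal r_gt0)).
rewrite H0 comm_adE mul0r mulr0 subrr in X0.
have x0 := cher_x_eq0 hPhi hPos hc (esym X0).
have := hx (Ordinal r_gt0) (Ordinal r_gt0).
by rewrite (frame_dual hy hx) x0 mul0mx mxE eqxx => /esym/eqP; rewrite oner_eq0.
Qed.
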